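(* Let $\alpha\in[0,1)$, let $\zeta\in\mathbb{C}$ with $|\zeta|\leq1$ satisfy $\operatorname{Re}([k]_\zeta)>\alpha$ for all positive integers $k$, and let $f(z)=z+\sum_{n=2}^{\infty}a_nz^n\in S_\zeta^*(\alpha)$. Then for every integer $n\geq2$ such that $[k]_\zeta\neq1$ for all $2\le k\le n$, $$|a_n|\leq\prod_{k=2}^n\left|\frac{(1-2\alpha)+[k-1]_\zeta}{[k]_\zeta-1}\right|.$$
   Context: Let $\mathbb{D}=\{z\in\mathbb{C}:|z|<1\}$ and let $\mathcal{A}$ be the family of analytic functions $f$ on $\mathbb{D}$ of the form $f(z)=z+a_2z^2+a_3z^3+\cdots$. For $\zeta\in\mathbb{C}$ with $|\zeta|\le1$ and an integer $n\ge1$ put $[n]_\zeta=1+\zeta+\zeta^2+\cdots+\zeta^{n-1}$. The operator $D_\zeta$ is defined on $\mathcal{A}$ by $D_\zeta f(z)=\frac1z\left\{f(z)\ast\frac{z}{(1-\zeta z)(1-z)}\right\}$, where $\ast$ is the Hadamard product (coefficientwise product of power series); equivalently $D_\zeta f(z)=\sum_{n\ge1}[n]_\zeta a_nz^{n-1}$ (with $a_1=1$). For $\alpha\in[0,1)$, the class $S_\zeta^*(\alpha)$ of $\zeta$-starlike functions of order $\alpha$ consists of all $f\in\mathcal{A}$ with $\operatorname{Re}\frac{zD_\zeta f(z)}{f(z)}>\alpha$ for all $z\in\mathbb{D}$ (the quotient at $z=0$ being understood as its limit $1$). *)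

(* Defs.v *)
From Stdlib Require Export Reals List.
From Coquelicot Require Export Coquelicot.

Local Open Scope C_scope.

Definition unit_disk (z : C) : Prop := (Cmod z < 1)%R.

Definition disk_expansion (a : nat -> C) (f : C -> C) : Prop :=
  forall z : C, unit_disk z -> @is_pseries C_AbsRing C_NormedModule a z (f z).

(** Analyticity on the unit disk is expressed by the Taylor
    expansion at the origin converging on the whole disk; values of [f] outside
    the disk are irrelevant. *)
Definition analytic_on_disk (f : C -> C) : Prop :=
  exists a : nat -> C, disk_expansion a f.

(** [f z = z + a 2 * z ^ 2 + a 3 * z ^ 3 + ...] on the unit disk. *)
Definition normalized_expansion (a : nat -> C) (f : C -> C) : Prop :=
  a 0%nat = 0 /\ a 1%nat = 1 /\ disk_expansion a f.

Definition class_A (f : C -> C) : Prop :=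
  exists a : nat -> C, normalized_expansion a f.

(** [zbracket zeta n = 1 + zeta + ... + zeta ^ (n - 1)]. *)
Fixpoint zbracket (zeta : C) (n : nat) : C :=
  match n with
  | O => 0
  | S m => zbracket zeta m + zeta ^ m
  end.

(** [h] is the Hadamard product of [f] and [g]. *)
Definition is_hadamard (f g h : C -> C) : Prop :=
  exists a b : nat -> C,
    disk_expansion a f /\ disk_expansion b g /\
    disk_expansion (fun n => a n * b n) h.

Definition zkernel (zeta z : C) : C := z / ((1 - zeta * z) * (1 - z)).

(** [g] is [D_zeta f] on the unit disk. The formula [h z / z] only makes sense
    off the origin; analyticity of [g] fixes its value there. *)
Definition is_zderiv (zeta : C) (f g : C -> C) : Prop :=
  analytic_on_disk g /\
  exists h : C -> C,
    is_hadamard f (zkernel zeta) h /\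
    forall z : C, unit_disk z -> z <> 0 -> g z = 1 / z * h z.

(** [z * g z / f z], with its limit [1] at the origin. *)
Definition starlike_quotient (f g : C -> C) (z : C) : C :=
  if Ceq_dec z 0 then 1 else z * g z / f z.

(** The quotient has to be defined throughout the disk, so [f] may vanish only
    at the origin (division by [0] is total in the library). *)
Definition zstarlike (zeta : C) (alpha : R) (f : C -> C) : Prop :=
  class_A f /\
  exists g : C -> C,
    is_zderiv zeta f g /\
    forall z : C, unit_disk z ->
      (z <> 0 -> f z <> 0) /\ (alpha < Re (starlike_quotient f g z))%R.

(* Main.v *)
Require Import Defs.
From Stdlib Require Import Reals List Arith Lra Lia IndefiniteDescription.
From Coquelicot Require Import Coquelicot.

(** Write [D f] for the zeta-derivative, so that the coefficient of [z ^ n] in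
    [z D f] is [zbracket zeta n * a n], abbreviated [[n] a_n]. The half-plane condition on [p = z D f / f] says
    that [G = z D f - f = f (p - 1)] satisfies [|G| <= |F|], where
    [F = z D f + (1 - 2 alpha) f], and that [F / z] has no zero in the disk; the
    coefficients of [G] and [F] are [([n] - 1) a_n] and [([n] + 1 - 2 alpha) a_n].
    Since [G] starts at [z ^ 2] and [F] at [z], Clunie's method compares partial
    sums of squares: the sum of [|[k] - 1|^2 |a_k|^2] over [2 <= k <= n] is at
    most the sum of [|[k] + 1 - 2 alpha|^2 |a_k|^2] over [1 <= k < n]
    ([zstarlike_coef_sums]). The difference of the two weights at [k] is
    [4 (1 - alpha) (Re [k] - alpha) >= 0], so the inequality may be solved
    recursively, and equality throughout gives exactly the product of the
    statement ([clunie_recursion]).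

    Clunie's inequality rests on the mean value property for quotients of power
    series with a zero-free denominator ([bounded_quotient_coef_sums]). It is
    obtained here without integrals or derivatives. A function is called tame
    on a closed disk when its divided differences of order at most two are
    bounded there. Power series are tame on smaller disks, and tameness passes
    to sums, products and inverses of functions bounded away from zero
    ([disk_expansion_tame], [tame_mult], [tame_inv]). For a tame [h], the mean
    over the vertices of a regular [N]-gon differs from [h 0] by [O(1 / N)]:
    enlarging the polygon moves each vertex by a fixed complex multiple of its
    displacement to the next vertex, and the increments of [h] along the closed
    polygon sum to zero ([ring_sum_step], [ring_sum_center]). Parseval's formula
    for polynomials follows, in the limit [N -> oo]. *)

Local Open Scope C_scope.

(** * Finite sums and limits *)

(** Sum of [u k] over [k < n]. *)
Fixpoint Csum (u : nat -> C) (n : nat) : C :=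
  match n with
  | O => 0
  | S m => Csum u m + u m
  end.

(** Sum of [u k] over [k < n]. *)
Fixpoint Rsum (u : nat -> R) (n : nat) : R :=
  match n with
  | O => 0%R
  | S m => (Rsum u m + u m)%R
  end.

(** Convergence of a complex sequence, as convergence to [0] of the moduli of
    the differences. *)
Definition Clim (u : nat -> C) (l : C) : Prop :=
  is_lim_seq (fun n => Cmod (u n - l)) 0%R.

Lemma Csum_ext u v n :
  (forall k, (k < n)%nat -> u k = v k) -> Csum u n = Csum v n.
Proof.
  induction n as [|n IH]; intros H; [easy|].
  simpl; rewrite IH; [rewrite H; [easy|lia]|intros; apply H; lia].
Qed.

Lemma Csum_plus u v n :
  Csum (fun k => u k + v k) n = Csum u n + Csum v n.
Proof. induction n as [|n IH]; simpl; [|rewrite IH]; ring. Qed.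

Lemma Csum_scal c u n : Csum (fun k => c * u k) n = c * Csum u n.
Proof. induction n as [|n IH]; simpl; [|rewrite IH]; ring. Qed.

Lemma Csum_shift u n : Csum u (S n) = u O + Csum (fun k => u (S k)) n.
Proof.
  induction n as [|n IH]; [simpl; ring|].
  change (Csum u (S (S n))) with (Csum u (S n) + u (S n)).
  rewrite IH; simpl; ring.
Qed.

Lemma Csum_conj u n : Cconj (Csum u n) = Csum (fun k => Cconj (u k)) n.
Proof.
  induction n as [|n IH]; simpl.
  - apply injective_projections; simpl; ring.
  - now rewrite Cplus_conj, IH.
Qed.

Lemma Rsum_ext u v n :
  (forall k, (k < n)%nat -> u k = v k) -> Rsum u n = Rsum v n.
Proof.
  induction n as [|n IH]; intros H; [easy|].
  simpl; rewrite IH; [rewrite H; [easy|lia]|intros; apply H; lia].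
Qed.

Lemma Rsum_le u v n :
  (forall k, (k < n)%nat -> u k <= v k)%R -> (Rsum u n <= Rsum v n)%R.
Proof.
  induction n as [|n IH]; intros H; simpl; [lra|].
  apply Rplus_le_compat; [apply IH; intros|]; apply H; lia.
Qed.

Lemma Rsum_plus u v n :
  Rsum (fun k => u k + v k)%R n = (Rsum u n + Rsum v n)%R.
Proof. induction n as [|n IH]; simpl; [|rewrite IH]; ring. Qed.

Lemma Rsum_scal c u n : Rsum (fun k => c * u k)%R n = (c * Rsum u n)%R.
Proof. induction n as [|n IH]; simpl; [|rewrite IH]; ring. Qed.

Lemma Rsum_const c n : Rsum (fun _ => c) n = (INR n * c)%R.
Proof. induction n as [|n IH]; [simpl; ring|]. rewrite S_INR; simpl; rewrite IH; ring. Qed.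

Lemma Rsum_shift u n : Rsum u (S n) = (u O + Rsum (fun k => u (S k)) n)%R.
Proof.
  induction n as [|n IH]; [simpl; ring|].
  change (Rsum u (S (S n))) with (Rsum u (S n) + u (S n))%R.
  rewrite IH; simpl; ring.
Qed.

Lemma Re_Csum u n : Re (Csum u n) = Rsum (fun k => Re (u k)) n.
Proof. induction n as [|n IH]; simpl; [easy|]. now rewrite <- IH. Qed.

Lemma Cmod_Csum u n : (Cmod (Csum u n) <= Rsum (fun k => Cmod (u k)) n)%R.
Proof.
  induction n as [|n IH]; simpl; [rewrite Cmod_0; lra|].
  eapply Rle_trans; [apply Cmod_triangle|lra].
Qed.

Lemma Cmod_minus_sym x y : Cmod (x - y) = Cmod (y - x).
Proof. rewrite <- Cmod_opp; f_equal; ring. Qed.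

Lemma Clim_bound (u : nat -> C) l K :
  Clim u l -> (forall n, Cmod (u n) <= K)%R -> (Cmod l <= K)%R.
Proof.
  intros H HK.
  assert (H2 : is_lim_seq (fun n => K + Cmod (u n - l))%R (K + 0)%R).
  { apply is_lim_seq_plus'; [apply is_lim_seq_const|exact H]. }
  replace K with (K + 0)%R by ring.
  refine (is_lim_seq_le (fun _ => Cmod l) _ (Cmod l) (K + 0)%R _ _ H2).
  - intros n. replace l with (u n + - (u n - l)) at 1 by ring.
    eapply Rle_trans; [apply Cmod_triangle|].
    rewrite Cmod_opp. specialize (HK n); lra.
  - apply is_lim_seq_const.
Qed.

Lemma Clim_le0 (u : nat -> C) l (v : nat -> R) :
  (forall n, Cmod (u n - l) <= v n)%R -> is_lim_seq v 0%R -> Clim u l.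
Proof.
  intros H Hv. unfold Clim.
  refine (is_lim_seq_le_le (fun _ => 0%R) _ v 0%R _ _ Hv).
  - intros n; split; [apply Cmod_ge_0|apply H].
  - apply is_lim_seq_const.
Qed.

Lemma Clim_ext u v l : (forall n, u n = v n) -> Clim u l -> Clim v l.
Proof.
  intros E H. eapply is_lim_seq_ext; [|exact H]. intros n; simpl; now rewrite E.
Qed.

Lemma Clim_plus u v l m : Clim u l -> Clim v m -> Clim (fun n => u n + v n) (l + m).
Proof.
  intros Hu Hv.
  apply (Clim_le0 _ _ (fun n => Cmod (u n - l) + Cmod (v n - m))%R).
  - intros n. replace (u n + v n - (l + m)) with ((u n - l) + (v n - m)) by ring.
    apply Cmod_triangle.
  - replace 0%R with (0 + 0)%R by ring. now apply is_lim_seq_plus'.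
Qed.

Lemma Clim_const c : Clim (fun _ => c) c.
Proof.
  apply (Clim_le0 _ _ (fun _ => 0%R)); [|apply is_lim_seq_const].
  intros n. replace (c - c) with (RtoC 0) by ring. rewrite Cmod_0; lra.
Qed.

Lemma Clim_scal c u l : Clim u l -> Clim (fun n => c * u n) (c * l).
Proof.
  intros Hu.
  apply (Clim_le0 _ _ (fun n => Cmod c * Cmod (u n - l))%R).
  - intros n. replace (c * u n - c * l) with (c * (u n - l)) by ring.
    rewrite Cmod_mult; lra.
  - replace 0%R with (Cmod c * 0)%R by ring. now apply (is_lim_seq_scal_l _ (Cmod c) 0%R).
Qed.

Lemma Clim_incr u l : Clim (fun n => u (S n)) l <-> Clim u l.
Proof.
  unfold Clim.
  exact (iff_sym (is_lim_seq_incr_1 (fun n => Cmod (u n - l)) 0%R)).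
Qed.

Lemma Clim_unique u l m : Clim u l -> Clim u m -> l = m.
Proof.
  intros Hl Hm.
  assert (H : Clim (fun n => u n + (-1) * u n) (l + (-1) * m)).
  { apply Clim_plus; [exact Hl|now apply Clim_scal]. }
  assert (H0 : (Cmod (l + (-1) * m) <= 0)%R).
  { apply (Clim_bound _ _ _ H). intros n.
    replace (u n + -1 * u n) with (RtoC 0) by ring. rewrite Cmod_0; lra. }
  assert (E : l + (-1) * m = 0).
  { apply Cmod_eq_0. pose proof (Cmod_ge_0 (l + (-1) * m)); lra. }
  replace l with (l + (-1) * m + m) by ring. rewrite E; ring.
Qed.

(** * Power series on the unit disk *)

Lemma sum_n_Csum (u : nat -> C) n :
  @sum_n C_AbelianMonoid u n = Csum u (S n).
Proof.
  induction n as [|n IH].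
  - rewrite sum_O; simpl; ring.
  - rewrite sum_Sn, IH; reflexivity.
Qed.

Lemma pow_n_Cpow (z : C) k : @pow_n C_Ring z k = z ^ k.
Proof. induction k as [|k IH]; [easy|]. simpl; now rewrite IH. Qed.

Lemma is_pseries_Clim (a : nat -> C) (z l : C) :
  @is_pseries C_AbsRing C_NormedModule a z l <->
  Clim (Csum (fun k => a k * z ^ k)) l.
Proof.
  assert (E : forall n, @sum_n C_AbelianMonoid
     (fun k => @scal _ C_NormedModule (@pow_n C_AbsRing z k) (a k)) n
     = Csum (fun k => a k * z ^ k) (S n)).
  { intros n. rewrite sum_n_Csum. apply Csum_ext. intros k _.
    change (@pow_n C_Ring z k * a k = a k * z ^ k). rewrite pow_n_Cpow; ring. }
  rewrite <- Clim_incr. unfold is_pseries, is_series.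
  refine (iff_trans (filterlim_locally_ball_norm (K := C_AbsRing)
                       (U := C_NormedModule) _ _) _).
  unfold Clim. rewrite <- is_lim_seq_spec. unfold is_lim_seq'.
  split; intros H eps; specialize (H eps).
  - destruct H as [N HN]. exists N. intros n Hn. specialize (HN n Hn).
    unfold ball_norm in HN. rewrite <- E.
    rewrite Rminus_0_r, Rabs_pos_eq by apply Cmod_ge_0. exact HN.
  - destruct H as [N HN]. exists N. intros n Hn. specialize (HN n Hn).
    unfold ball_norm. rewrite <- E in HN.
    rewrite Rminus_0_r, Rabs_pos_eq in HN by apply Cmod_ge_0. exact HN.
Qed.

Lemma disk_expansion_Clim a f :
  disk_expansion a f <->
  forall z, (Cmod z < 1)%R -> Clim (Csum (fun k => a k * z ^ k)) (f z).
Proof.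
  unfold disk_expansion, unit_disk.
  split; intros H z Hz; apply is_pseries_Clim, H, Hz.
Qed.

Lemma disk_expansion_ext a b f g :
  (forall n, a n = b n) -> (forall z, (Cmod z < 1)%R -> f z = g z) ->
  disk_expansion a f -> disk_expansion b g.
Proof.
  rewrite !disk_expansion_Clim. intros Ea Ef H z Hz. rewrite <- Ef by easy.
  apply (Clim_ext (Csum (fun k => a k * z ^ k))); [|now apply H].
  intros n. apply Csum_ext. intros k _. now rewrite Ea.
Qed.

Lemma disk_expansion_at_0 a f : disk_expansion a f -> f 0 = a O.
Proof.
  intros H. apply disk_expansion_Clim with (z := RtoC 0) in H;
    [|rewrite Cmod_0; lra].
  apply (Clim_unique _ _ _ H). apply Clim_incr.
  apply (Clim_ext (fun _ => a O)); [|apply Clim_const].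
  intros n. rewrite Csum_shift.
  rewrite (Csum_ext _ (fun k => 0 * 0)) by (intros; rewrite Cpow_S; ring).
  rewrite Csum_scal. simpl; ring.
Qed.

Lemma disk_expansion_lin (c d : C) a b f g :
  disk_expansion a f -> disk_expansion b g ->
  disk_expansion (fun k => c * a k + d * b k) (fun z => c * f z + d * g z).
Proof.
  rewrite !disk_expansion_Clim. intros Hf Hg z Hz.
  apply (Clim_ext (fun n => c * Csum (fun k => a k * z ^ k) n
                          + d * Csum (fun k => b k * z ^ k) n)).
  - intros n. rewrite <- !Csum_scal, <- Csum_plus. apply Csum_ext; intros; ring.
  - apply Clim_plus; apply Clim_scal; auto.
Qed.

Lemma disk_expansion_const c :
  disk_expansion (fun n => match n with O => c | S _ => 0 end) (fun _ => c).
Proof.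
  apply disk_expansion_Clim. intros z _. apply Clim_incr.
  apply (Clim_ext (fun _ => c)); [|apply Clim_const].
  intros n. rewrite Csum_shift, Csum_scal. simpl. ring.
Qed.

Lemma disk_expansion_mul_z a f : disk_expansion a f ->
  disk_expansion (fun n => match n with O => 0 | S k => a k end) (fun z => z * f z).
Proof.
  rewrite !disk_expansion_Clim. intros H z Hz. apply Clim_incr.
  apply (Clim_ext (fun n => z * Csum (fun k => a k * z ^ k) n)).
  - intros n. rewrite Csum_shift, <- Csum_scal.
    rewrite (Csum_ext (fun k => a k * z ^ S k) (fun k => z * (a k * z ^ k)))
      by (intros; simpl; ring).
    simpl. ring.
  - apply Clim_scal. now apply H.
Qed.

(** Division by [z] of a power series minus its constant term stays a power
    series on the whole disk. *)
Lemma disk_expansion_shift a f : disk_expansion a f ->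
  exists f1, disk_expansion (fun k => a (S k)) f1 /\
    forall z, (Cmod z < 1)%R -> f z = a O + z * f1 z.
Proof.
  intros H.
  exists (fun z => if Ceq_dec z 0 then a 1%nat else (f z - a O) / z).
  split.
  - apply disk_expansion_Clim. intros z Hz. destruct (Ceq_dec z 0) as [->|Hz0].
    + apply Clim_incr.
      apply (Clim_ext (fun _ => a 1%nat)); [|apply Clim_const].
      intros n. rewrite Csum_shift.
      rewrite (Csum_ext _ (fun k => 0 * 0)) by (intros; rewrite Cpow_S; ring).
      rewrite Csum_scal. simpl; ring.
    + rewrite disk_expansion_Clim in H. specialize (H z Hz).
      apply Clim_incr in H.
      apply (Clim_ext (fun n => / z * (Csum (fun k => a k * z ^ k) (S n) + - a O))).
      * intros n. rewrite Csum_shift.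
        rewrite (Csum_ext (fun k => a (S k) * z ^ S k)
                   (fun k => z * (a (S k) * z ^ k)))
          by (intros; rewrite Cpow_S; ring).
        rewrite Csum_scal. simpl. field; exact Hz0.
      * replace ((f z - a O) / z) with (/ z * (f z + - a O)) by (field; exact Hz0).
        apply Clim_scal, Clim_plus; [exact H|apply Clim_const].
  - intros z Hz. destruct (Ceq_dec z 0) as [->|Hz0].
    + rewrite (disk_expansion_at_0 a f H); ring.
    + field; exact Hz0.
Qed.

Lemma disk_expansion_tail a f m : disk_expansion a f ->
  exists fm, disk_expansion (fun k => a (m + k)%nat) fm /\
    forall z, (Cmod z < 1)%R ->
      f z = Csum (fun k => a k * z ^ k) m + z ^ m * fm z.
Proof.
  intros H. induction m as [|m [fm [Hfm E]]].
  - exists f. split; [exact H|]. intros; simpl; ring.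
  - destruct (disk_expansion_shift _ _ Hfm) as [g [Hg Eg]].
    exists g. split.
    + replace (fun k => a (S m + k)%nat) with (fun k => a (m + S k)%nat); [easy|].
      apply FunctionalExtensionality.functional_extensionality.
      intros k; f_equal; lia.
    + intros z Hz. rewrite (E z Hz), (Eg z Hz), Nat.add_0_r. simpl. ring.
Qed.

(** * Functions with bounded divided differences *)

(** [h] and its divided differences of orders one and two are bounded by [K] on
    the closed disk of radius [r]. The third inequality is the bound on the
    second divided difference with denominators cleared, so the points may
    coincide. This expresses complex differentiability with a Lipschitz
    derivative without naming the derivative. *)
Definition tame_by (K r : R) (h : C -> C) : Prop :=
  forall x y z, (Cmod x <= r)%R -> (Cmod y <= r)%R -> (Cmod z <= r)%R ->
    (Cmod (h z) <= K)%R /\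
    (Cmod (h x - h z) <= K * Cmod (x - z))%R /\
    (Cmod ((y - z) * (h x - h z) - (x - z) * (h y - h z))
      <= K * (Cmod (x - z) * Cmod (y - z) * Cmod (x - y)))%R.

Definition tame (r : R) (h : C -> C) : Prop := exists K, tame_by K r h.

Lemma tame_by_nonneg K r h : (0 <= r)%R -> tame_by K r h -> (0 <= K)%R.
Proof.
  intros Hr H. assert (H0 : (Cmod 0 <= r)%R) by (rewrite Cmod_0; lra).
  destruct (H _ _ _ H0 H0 H0) as [H1 _]. pose proof (Cmod_ge_0 (h 0)). lra.
Qed.

Lemma tame_by_lim K r (hn : nat -> C -> C) h :
  (forall n, tame_by K r (hn n)) ->
  (forall z, (Cmod z <= r)%R -> Clim (fun n => hn n z) (h z)) ->
  tame_by K r h.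
Proof.
  intros Hn Hl x y z Hx Hy Hz.
  assert (L : forall u v, (Cmod u <= r)%R -> (Cmod v <= r)%R ->
            Clim (fun n => hn n u - hn n v) (h u - h v)).
  { intros u v Hu Hv.
    apply (Clim_ext (fun n => hn n u + (-1) * hn n v)); [intros; ring|].
    replace (h u - h v) with (h u + (-1) * h v) by ring.
    apply Clim_plus; [|apply Clim_scal]; auto. }
  split; [|split].
  - apply (Clim_bound _ _ _ (Hl z Hz)). intros n. now apply (Hn n x y z).
  - apply (Clim_bound _ _ _ (L x z Hx Hz)). intros n. now apply (Hn n x y z).
  - refine (Clim_bound (fun n => (y - z) * (hn n x - hn n z)
                           - (x - z) * (hn n y - hn n z)) _ _ _ _).
    + apply (Clim_ext (fun n => (y - z) * (hn n x - hn n z)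
                           + (- (x - z)) * (hn n y - hn n z))); [intros; ring|].
      replace ((y - z) * (h x - h z) - (x - z) * (h y - h z)) with
        ((y - z) * (h x - h z) + (- (x - z)) * (h y - h z)) by ring.
      apply Clim_plus; apply Clim_scal; auto.
    + intros n. now apply (Hn n x y z).
Qed.

Lemma tame_by_ext K r h k :
  (forall z, (Cmod z <= r)%R -> h z = k z) -> tame_by K r h -> tame_by K r k.
Proof.
  intros E H x y z Hx Hy Hz.
  rewrite <- (E x Hx), <- (E y Hy), <- (E z Hz). now apply H.
Qed.

Lemma tame_ext r h k :
  (forall z, (Cmod z <= r)%R -> h z = k z) -> tame r h -> tame r k.
Proof. intros E [K H]. exists K. exact (tame_by_ext _ _ _ _ E H). Qed.

Lemma tame_by_plus K L r h k :
  tame_by K r h -> tame_by L r k -> tame_by (K + L) r (fun z => h z + k z).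
Proof.
  intros Hh Hk x y z Hx Hy Hz.
  destruct (Hh x y z Hx Hy Hz) as (A1 & A2 & A3).
  destruct (Hk x y z Hx Hy Hz) as (B1 & B2 & B3).
  rewrite !Rmult_plus_distr_r.
  split; [|split].
  - eapply Rle_trans; [apply Cmod_triangle|lra].
  - replace (h x + k x - (h z + k z)) with ((h x - h z) + (k x - k z)) by ring.
    eapply Rle_trans; [apply Cmod_triangle|lra].
  - match goal with |- (Cmod ?t <= _)%R => replace t with
      (((y - z) * (h x - h z) - (x - z) * (h y - h z))
       + ((y - z) * (k x - k z) - (x - z) * (k y - k z))) by ring end.
    eapply Rle_trans; [apply Cmod_triangle|lra].
Qed.

Lemma tame_by_scal c K r h :
  tame_by K r h -> tame_by (Cmod c * K) r (fun z => c * h z).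
Proof.
  intros Hh x y z Hx Hy Hz.
  destruct (Hh x y z Hx Hy Hz) as (A1 & A2 & A3).
  split; [|split].
  - rewrite Cmod_mult. apply Rmult_le_compat_l; [apply Cmod_ge_0|easy].
  - replace (c * h x - c * h z) with (c * (h x - h z)) by ring.
    rewrite Cmod_mult, (Rmult_assoc (Cmod c) K). apply Rmult_le_compat_l; [apply Cmod_ge_0|easy].
  - match goal with |- (Cmod ?t <= _)%R => replace t with
      (c * ((y - z) * (h x - h z) - (x - z) * (h y - h z))) by ring end.
    rewrite Cmod_mult, (Rmult_assoc (Cmod c) K). apply Rmult_le_compat_l; [apply Cmod_ge_0|easy].
Qed.

Lemma tame_by_weaken K L r h : (K <= L)%R -> tame_by K r h -> tame_by L r h.
Proof.
  intros HKL H x y z Hx Hy Hz.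
  destruct (H x y z Hx Hy Hz) as (A1 & A2 & A3).
  pose proof (Cmod_ge_0 (x - z)). pose proof (Cmod_ge_0 (y - z)).
  pose proof (Cmod_ge_0 (x - y)).
  split; [lra|split].
  - eapply Rle_trans; [exact A2|]. now apply Rmult_le_compat_r.
  - eapply Rle_trans; [exact A3|]. apply Rmult_le_compat_r; [|easy].
    repeat apply Rmult_le_pos; easy.
Qed.

Lemma tame_by_0 r : tame_by 0 r (fun _ => 0).
Proof.
  intros x y z _ _ _.
  replace (0 - 0) with (RtoC 0) by ring.
  replace ((y - z) * 0 - (x - z) * 0) with (RtoC 0) by ring.
  rewrite Cmod_0. lra.
Qed.

Lemma tame_plus r h k : tame r h -> tame r k -> tame r (fun z => h z + k z).
Proof. intros [K H] [L H']. exists (K + L)%R. now apply tame_by_plus. Qed.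

Lemma tame_scal c r h : tame r h -> tame r (fun z => c * h z).
Proof. intros [K H]. exists (Cmod c * K)%R. now apply tame_by_scal. Qed.

(** Leibniz rule for second divided differences. *)
Lemma tame_mult r h k : tame r h -> tame r k -> tame r (fun z => h z * k z).
Proof.
  intros [K H] [L H'].
  exists (K * L + K * L + K * L)%R. intros x y z Hx Hy Hz.
  destruct (H x y z Hx Hy Hz) as (A1 & A2 & A3).
  destruct (H y x z Hy Hx Hz) as (_ & A2' & _).
  destruct (H' x y z Hx Hy Hz) as (B1 & B2 & B3).
  destruct (H' x z y Hx Hz Hy) as (_ & B2' & _).
  destruct (H' x z x Hx Hz Hx) as (B1' & _ & _).
  pose proof (Cmod_ge_0 (x - z)) as P1. pose proof (Cmod_ge_0 (y - z)) as P2.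
  pose proof (Cmod_ge_0 (x - y)) as P3.
  pose proof (Cmod_ge_0 (h z)) as P4. pose proof (Cmod_ge_0 (k z)) as P5.
  assert (HK : (0 <= K)%R) by lra. assert (HL : (0 <= L)%R) by lra.
  pose proof (Rmult_le_pos _ _ HK HL) as HKL.
  split; [|split].
  - rewrite Cmod_mult.
    assert (Cmod (h z) * Cmod (k z) <= K * L)%R
      by (apply Rmult_le_compat; auto).
    lra.
  - replace (h x * k x - h z * k z) with ((h x - h z) * k x + h z * (k x - k z))
      by ring.
    eapply Rle_trans; [apply Cmod_triangle|]. rewrite !Cmod_mult.
    assert (Cmod (h x - h z) * Cmod (k x) <= K * Cmod (x - z) * L)%R
      by (apply Rmult_le_compat; auto using Cmod_ge_0).
    assert (Cmod (h z) * Cmod (k x - k z) <= K * (L * Cmod (x - z)))%R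
      by (apply Rmult_le_compat; auto using Cmod_ge_0).
    pose proof (Rmult_le_pos _ _ HKL P1). lra.
  - match goal with |- (Cmod ?t <= _)%R => replace t with
      (((y - z) * (h x - h z) - (x - z) * (h y - h z)) * k x
       + h z * ((y - z) * (k x - k z) - (x - z) * (k y - k z))
       + (x - z) * (h y - h z) * (k x - k y)) by ring end.
    eapply Rle_trans; [apply Cmod_triangle|].
    rewrite !Rmult_plus_distr_r. apply Rplus_le_compat.
    + eapply Rle_trans; [apply Cmod_triangle|].
      rewrite !(Cmod_mult (_ - _) (k x)), (Cmod_mult (h z)).
      apply Rplus_le_compat.
      * eapply Rle_trans; [apply Rmult_le_compat; try apply Cmod_ge_0;
                           [exact A3|exact B1']|lra].
      * eapply Rle_trans; [apply Rmult_le_compat; try apply Cmod_ge_0;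
                           [exact A1|exact B3]|lra].
    + rewrite !Cmod_mult.
      eapply Rle_trans; [apply Rmult_le_compat|].
      * apply Rmult_le_pos; apply Cmod_ge_0.
      * apply Cmod_ge_0.
      * apply Rmult_le_compat; [apply Cmod_ge_0|apply Cmod_ge_0|
                                apply Rle_refl|exact A2'].
      * exact B2'.
      * lra.
Qed.

Lemma tame_inv r h c : (0 < c)%R ->
  (forall z, (Cmod z <= r)%R -> (c <= Cmod (h z))%R) ->
  tame r h -> tame r (fun z => / h z).
Proof.
  intros Hc Hlow [K H].
  assert (Hnz : forall z, (Cmod z <= r)%R -> h z <> 0).
  { intros z Hz E. specialize (Hlow z Hz). rewrite E, Cmod_0 in Hlow. lra. }
  set (I := (/ c)%R).
  assert (HI : (0 < I)%R) by now apply Rinv_0_lt_compat.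
  assert (Hinv : forall z, (Cmod z <= r)%R -> (Cmod (/ h z) <= I)%R).
  { intros z Hz. rewrite Cmod_inv by now apply Hnz.
    apply Rinv_le_contravar; auto. }
  exists (I + I * I * K + I * I * K + I * I * I * K * K)%R.
  intros x y z Hx Hy Hz.
  destruct (H x y z Hx Hy Hz) as (A1 & A2 & A3).
  destruct (H y x z Hy Hx Hz) as (_ & A2' & _).
  destruct (H y z x Hy Hz Hx) as (_ & A2'' & _).
  pose proof (Hnz x Hx) as Nx. pose proof (Hnz y Hy) as Ny.
  pose proof (Hnz z Hz) as Nz.
  pose proof (Hinv x Hx) as Ix. pose proof (Hinv y Hy) as Iy.
  pose proof (Hinv z Hz) as Iz.
  pose proof (Cmod_ge_0 (x - z)) as P1. pose proof (Cmod_ge_0 (y - z)) as P2.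
  pose proof (Cmod_ge_0 (x - y)) as P3.
  pose proof (Cmod_ge_0 (h z)) as P4.
  assert (HK : (0 <= K)%R) by lra.
  assert (Q1 : (0 <= I * I)%R) by (apply Rmult_le_pos; lra).
  assert (Q2 : (0 <= I * I * K)%R) by now apply Rmult_le_pos.
  assert (Q3 : (0 <= I * I * I * K * K)%R)
    by (repeat apply Rmult_le_pos; lra).
  split; [|split].
  - lra.
  - replace (/ h x - / h z) with (- (h x - h z) * (/ h x * / h z))
      by (field; auto).
    rewrite !Cmod_mult, Cmod_opp.
    eapply Rle_trans with (K * Cmod (x - z) * (I * I))%R.
    + apply Rmult_le_compat; auto using Cmod_ge_0.
      * apply Rmult_le_pos; apply Cmod_ge_0.
      * apply Rmult_le_compat; auto using Cmod_ge_0.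
    + rewrite !Rmult_plus_distr_r.
      pose proof (Rmult_le_pos _ _ Q2 P1). pose proof (Rmult_le_pos _ _ Q3 P1).
      assert (0 <= I * Cmod (x - z))%R by (apply Rmult_le_pos; lra). lra.
  - match goal with |- (Cmod ?t <= _)%R => replace t with
      (- ((y - z) * (h x - h z) - (x - z) * (h y - h z)) * (/ h x * / h z)
       + (x - z) * (h y - h z) * (h x - h y) * (/ h x * / h y * / h z))
      by (field; auto) end.
    eapply Rle_trans; [apply Cmod_triangle|].
    rewrite (Cmod_mult (- _)), !Cmod_opp.
    rewrite (Cmod_mult (_ * _ * _)).
    rewrite !(Cmod_mult (/ _) (/ _)), (Cmod_mult (_ * / _) (/ _)),
      !(Cmod_mult (/ _) (/ _)), (Cmod_mult ((x - z) * (h y - h z))),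
      (Cmod_mult (x - z) (h y - h z)).
    set (W := (Cmod (x - z) * Cmod (y - z) * Cmod (x - y))%R) in *.
    assert (HW : (0 <= W)%R) by (unfold W; repeat apply Rmult_le_pos; auto).
    eapply Rle_trans with (K * W * (I * I) + K * K * W * (I * I * I))%R.
    + apply Rplus_le_compat.
      * apply Rmult_le_compat; auto using Cmod_ge_0.
        -- apply Rmult_le_pos; apply Cmod_ge_0.
        -- apply Rmult_le_compat; auto using Cmod_ge_0.
      * apply Rmult_le_compat.
        -- repeat apply Rmult_le_pos; apply Cmod_ge_0.
        -- repeat apply Rmult_le_pos; apply Cmod_ge_0.
        -- replace (K * K * W)%R with
             (Cmod (x - z) * (K * Cmod (y - z)) * (K * Cmod (x - y)))%R
             by (unfold W; ring).
           apply Rmult_le_compat; auto using Cmod_ge_0.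
           ++ repeat apply Rmult_le_pos; apply Cmod_ge_0.
           ++ apply Rmult_le_compat_l; auto.
           ++ rewrite (Cmod_minus_sym (h x)), (Cmod_minus_sym x). exact A2''.
        -- repeat apply Rmult_le_compat; auto using Cmod_ge_0.
           apply Rmult_le_pos; apply Cmod_ge_0.
    + rewrite !Rmult_plus_distr_r.
      pose proof (Rmult_le_pos _ _ Q2 HW). pose proof (Rmult_le_pos _ _ Q3 HW).
      assert (0 <= I * W)%R by (apply Rmult_le_pos; lra). lra.
Qed.

(** The weaker constants [rho ^ n / (rho - r)] and [rho ^ n / (rho - r) ^ 2]
    replace the sharp [n r ^ (n - 1)] and its second-order analogue: each
    inductive step then closes as an equality, and the bounds are summable
    against the coefficients of a power series. *)
Lemma tame_by_pow r rho n : (0 <= r)%R -> (r < rho <= 1)%R ->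
  tame_by (rho ^ n / (rho - r) ^ 2) r (fun z => z ^ n).
Proof.
  intros Hr [Hrho Hrho1]. set (e := (rho - r)%R).
  assert (He : (0 < e)%R) by (unfold e; lra).
  assert (He1 : (e <= 1)%R) by (unfold e; lra).
  assert (Hpow : forall k, (r ^ k <= rho ^ k)%R) by (intros; apply pow_incr; lra).
  assert (V0 : forall z k, (Cmod z <= r)%R -> (Cmod (z ^ k) <= r ^ k)%R).
  { intros z k Hz. rewrite Cmod_pow. apply pow_incr. split; [apply Cmod_ge_0|easy]. }
  assert (V1 : forall k x z, (Cmod x <= r)%R -> (Cmod z <= r)%R ->
    (Cmod (x ^ k - z ^ k) <= rho ^ k / e * Cmod (x - z))%R).
  { intros k x z Hx Hz. induction k as [|k IH].
    - replace (x ^ 0 - z ^ 0) with (RtoC 0) by (simpl; ring). rewrite Cmod_0.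
      apply Rmult_le_pos; [|apply Cmod_ge_0]. apply Rdiv_le_0_compat; simpl; lra.
    - replace (x ^ S k - z ^ S k) with (x * (x ^ k - z ^ k) + z ^ k * (x - z))
        by (simpl; ring).
      eapply Rle_trans; [apply Cmod_triangle|]. rewrite !Cmod_mult.
      eapply Rle_trans with (r * (rho ^ k / e * Cmod (x - z)) + rho ^ k * Cmod (x - z))%R.
      + apply Rplus_le_compat.
        * apply Rmult_le_compat; auto using Cmod_ge_0.
        * apply Rmult_le_compat_r; [apply Cmod_ge_0|].
          eapply Rle_trans; [apply V0; easy|apply Hpow].
      + apply Req_le. unfold e; simpl; field; lra. }
  assert (V2 : forall k x y z, (Cmod x <= r)%R -> (Cmod y <= r)%R -> (Cmod z <= r)%R ->
    (Cmod ((y - z) * (x ^ k - z ^ k) - (x - z) * (y ^ k - z ^ k))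
      <= rho ^ k / e ^ 2 * (Cmod (x - z) * Cmod (y - z) * Cmod (x - y)))%R).
  { intros k x y z Hx Hy Hz.
    set (W := (Cmod (x - z) * Cmod (y - z) * Cmod (x - y))%R).
    assert (HW : (0 <= W)%R) by (unfold W; repeat apply Rmult_le_pos; apply Cmod_ge_0).
    induction k as [|k IH].
    - match goal with |- (Cmod ?t <= _)%R => replace t with (RtoC 0) by (simpl; ring) end.
      rewrite Cmod_0. apply Rmult_le_pos; [|easy].
      apply Rdiv_le_0_compat; [simpl; lra|]. now apply pow_lt.
    - match goal with |- (Cmod ?t <= _)%R => replace t with
        (z * ((y - z) * (x ^ k - z ^ k) - (x - z) * (y ^ k - z ^ k))
         + (x - z) * (y - z) * (x ^ k - y ^ k)) by (simpl; ring) end.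
      eapply Rle_trans; [apply Cmod_triangle|].
      rewrite (Cmod_mult z), (Cmod_mult ((x - z) * (y - z))), (Cmod_mult (x - z) (y - z)).
      eapply Rle_trans with (r * (rho ^ k / e ^ 2 * W) + rho ^ k / e * W)%R.
      + apply Rplus_le_compat.
        * apply Rmult_le_compat; auto using Cmod_ge_0.
        * replace (rho ^ k / e * W)%R with
            (Cmod (x - z) * Cmod (y - z) * (rho ^ k / e * Cmod (x - y)))%R
            by (unfold W; ring).
          apply Rmult_le_compat_l; [apply Rmult_le_pos; apply Cmod_ge_0|auto].
      + apply Req_le. unfold e; simpl; field; lra. }
  assert (Hp : (0 <= rho ^ n)%R) by (apply pow_le; lra).
  assert (Hi : (1 <= / e)%R).
  { rewrite <- Rinv_1. apply Rinv_le_contravar; lra. }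
  assert (B1 : (rho ^ n / e <= rho ^ n / e ^ 2)%R).
  { replace (rho ^ n / e ^ 2)%R with (rho ^ n / e * / e)%R by (field; lra).
    rewrite <- (Rmult_1_r (rho ^ n / e)) at 1. apply Rmult_le_compat_l; [|easy].
    apply Rdiv_le_0_compat; lra. }
  assert (B0 : (rho ^ n <= rho ^ n / e)%R).
  { unfold Rdiv. rewrite <- (Rmult_1_r (rho ^ n)) at 1.
    apply Rmult_le_compat_l; easy. }
  intros x y z Hx Hy Hz. split; [|split].
  - eapply Rle_trans; [apply V0; easy|]. specialize (Hpow n). lra.
  - eapply Rle_trans; [apply V1; easy|].
    apply Rmult_le_compat_r; [apply Cmod_ge_0|lra].
  - now apply V2.
Qed.

Lemma tame_pow r n : (0 <= r < 1)%R -> tame r (fun z => z ^ n).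
Proof. intros Hr. eexists. apply (tame_by_pow r 1 n); lra. Qed.

Lemma tame_0 r : tame r (fun _ => 0).
Proof. exists 0%R. apply tame_by_0. Qed.

Lemma tame_Csum r (h : nat -> C -> C) n :
  (forall k, (k < n)%nat -> tame r (h k)) -> tame r (fun z => Csum (fun k => h k z) n).
Proof.
  induction n as [|n IH]; intros H; simpl; [apply tame_0|].
  apply tame_plus; [apply IH; intros|]; apply H; lia.
Qed.

Lemma disk_expansion_coef_bound a f s : disk_expansion a f -> (0 < s < 1)%R ->
  exists M, (0 <= M)%R /\ forall k, (Cmod (a k) * s ^ k <= M)%R.
Proof.
  intros H Hs.
  assert (Hc : (Cmod (RtoC s) < 1)%R) by (rewrite Cmod_R, Rabs_pos_eq; lra).
  rewrite disk_expansion_Clim in H. specialize (H _ Hc).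
  assert (HT : Clim (fun k => a k * s ^ k) (f s + (-1) * f s)).
  { apply (Clim_ext (fun n => Csum (fun k => a k * s ^ k) (S n)
                     + (-1) * Csum (fun k => a k * s ^ k) n)).
    - intros n; simpl; ring.
    - apply Clim_plus; [now apply Clim_incr in H|now apply Clim_scal]. }
  assert (HT' : is_lim_seq (fun k => Cmod (a k) * s ^ k)%R 0%R).
  { eapply is_lim_seq_ext; [|exact HT]. intros k; simpl.
    replace (a k * s ^ k - (f s + -1 * f s)) with (a k * s ^ k) by ring.
    rewrite Cmod_mult, <- RtoC_pow, Cmod_R, Rabs_pos_eq; [easy|].
    apply pow_le; lra. }
  destruct (filterlim_bounded _ (ex_intro _ 0%R HT')) as [M HM].
  exists M. split.
  - eapply Rle_trans; [|apply (HM O)]. apply norm_ge_0.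
  - intros k. eapply Rle_trans; [|apply (HM k)]. apply Rle_abs.
Qed.

(** With [r < rho < s < 1] the coefficients are at most [M / s ^ n], so the
    constants of the monomials sum to a geometric series of ratio [rho / s]. *)
Lemma disk_expansion_tame a f r : disk_expansion a f -> (0 <= r < 1)%R -> tame r f.
Proof.
  intros H Hr.
  set (rho := ((2 * r + 1) / 3)%R). set (s := ((r + 2) / 3)%R).
  assert (Hrs : (r < rho < s)%R) by (unfold rho, s; lra).
  assert (Hs : (0 < s < 1)%R) by (unfold s; lra).
  destruct (disk_expansion_coef_bound a f s H Hs) as [M [HM0 HM]].
  set (q := (rho / s)%R).
  assert (Hq : (0 <= q < 1)%R).
  { unfold q. split; [apply Rdiv_le_0_compat; lra|].
    apply (Rmult_lt_reg_r s); [lra|]. unfold Rdiv.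
    rewrite Rmult_assoc, Rinv_l by lra. lra. }
  assert (He : (0 < (rho - r) ^ 2)%R) by (apply pow_lt; lra).
  set (E := (/ (rho - r) ^ 2)%R).
  assert (HE : (0 < E)%R) by (apply Rinv_0_lt_compat; easy).
  exists (M * E * / (1 - q))%R.
  apply (tame_by_lim _ _ (fun n z => Csum (fun k => a k * z ^ k) n)).
  2:{ intros z Hz. rewrite disk_expansion_Clim in H. apply H. lra. }
  intros n.
  apply tame_by_weaken with (M * E * ((1 - q ^ n) * / (1 - q)))%R.
  { apply Rmult_le_compat_l; [apply Rmult_le_pos; lra|].
    rewrite <- (Rmult_1_l (/ (1 - q))) at 2. apply Rmult_le_compat_r.
    - apply Rlt_le, Rinv_0_lt_compat; lra.
    - pose proof (pow_le q n (proj1 Hq)); lra. }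
  induction n as [|n IH].
  - simpl. replace (M * E * ((1 - 1) * / (1 - q)))%R with 0%R by ring. apply tame_by_0.
  - apply tame_by_weaken with
      (M * E * ((1 - q ^ n) * / (1 - q)) + Cmod (a n) * (rho ^ n / (rho - r) ^ 2))%R.
    + replace (M * E * ((1 - q ^ S n) * / (1 - q)))%R with
        (M * E * ((1 - q ^ n) * / (1 - q)) + (M * q ^ n) * E)%R
        by (simpl; field; lra).
      apply Rplus_le_compat_l. unfold Rdiv; fold E. rewrite <- Rmult_assoc.
      apply Rmult_le_compat_r; [lra|].
      replace (rho ^ n)%R with (s ^ n * q ^ n)%R.
      * rewrite <- Rmult_assoc. apply Rmult_le_compat_r; [now apply pow_le|apply HM].
      * rewrite <- Rpow_mult_distr. f_equal. unfold q; field; lra.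
    + simpl. apply tame_by_plus; [exact IH|].
      apply tame_by_scal, tame_by_pow; lra.
Qed.

(** The identity theorem at the origin is needed in punctured form, since
    quotients are only controlled off [0]. *)
Lemma disk_expansion_eq_0_at_0 c d : disk_expansion c d ->
  (forall z, (Cmod z < 1)%R -> z <> 0 -> d z = 0) -> d 0 = 0.
Proof.
  intros H Hd. destruct (Ceq_dec (d 0) 0) as [|Hne]; [easy|exfalso].
  destruct (disk_expansion_tame c d (1 / 2) H ltac:(lra)) as [K HK].
  pose proof (tame_by_nonneg K (1 / 2) d ltac:(lra) HK) as HK0.
  apply Cmod_gt_0 in Hne.
  set (t := Rmin (1 / 2) (Cmod (d 0) / (2 * (K + 1)))).
  assert (Ht1 : (t <= 1 / 2)%R) by apply Rmin_l.
  assert (Ht2 : (t <= Cmod (d 0) / (2 * (K + 1)))%R) by apply Rmin_r.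
  assert (Ht : (0 < t)%R)
    by (apply Rmin_glb_lt; [lra|apply Rdiv_lt_0_compat; lra]).
  assert (Hm : Cmod (RtoC t) = t) by (rewrite Cmod_R; apply Rabs_pos_eq; lra).
  assert (Hc : (Cmod 0 <= 1 / 2)%R) by (rewrite Cmod_0; lra).
  (* The Lipschitz bound gives |d 0| <= K t <= |d 0| / 2. *)
  destruct (HK 0 0 (RtoC t) Hc Hc ltac:(lra)) as (_ & HL & _).
  rewrite (Hd (RtoC t)) in HL;
    [|lra|intros E; rewrite E, Cmod_0 in Hm; lra].
  replace (d 0 - 0) with (d 0) in HL by ring.
  replace (0 - RtoC t) with (- RtoC t) in HL by ring.
  rewrite Cmod_opp, Hm in HL.
  assert (Ht3 : (t * (2 * (K + 1)) <= Cmod (d 0))%R).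
  { apply (Rmult_le_compat_r (2 * (K + 1))) in Ht2; [|lra].
    replace (Cmod (d 0) / (2 * (K + 1)) * (2 * (K + 1)))%R
      with (Cmod (d 0)) in Ht2 by (field; lra). exact Ht2. }
  nra.
Qed.

Lemma disk_expansion_eq_0 c d : disk_expansion c d ->
  (forall z, (Cmod z < 1)%R -> z <> 0 -> d z = 0) -> forall n, c n = 0.
Proof.
  intros H Hd n. revert c d H Hd.
  induction n as [|n IH]; intros c d H Hd;
    pose proof (disk_expansion_eq_0_at_0 c d H Hd) as H0;
    rewrite (disk_expansion_at_0 c d H) in H0; [exact H0|].
  destruct (disk_expansion_shift c d H) as [d1 [H1 E1]].
  apply (IH _ d1 H1). intros z Hz Hz0.
  pose proof (E1 z Hz) as E. rewrite (Hd z Hz Hz0), H0 in E.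
  replace (d1 z) with (/ z * (0 + z * d1 z)) by (field; easy).
  rewrite <- E. ring.
Qed.

Lemma disk_expansion_unique a b f g :
  disk_expansion a f -> disk_expansion b g ->
  (forall z, (Cmod z < 1)%R -> z <> 0 -> f z = g z) -> forall n, a n = b n.
Proof.
  intros Hf Hg E n.
  pose proof (disk_expansion_eq_0 _ _ (disk_expansion_lin 1 (-1) _ _ _ _ Hf Hg)) as H.
  assert (H0 : 1 * a n + -1 * b n = 0)
    by (apply H; intros z Hz Hz0; rewrite (E z Hz Hz0); ring).
  replace (a n) with (1 * a n + -1 * b n + b n) by ring.
  rewrite H0. ring.
Qed.

(** Compactness of the closed disk: around each [p] of the square, [delta] is
    either a radius on which the Lipschitz bound keeps [h] away from [0], or,
    when [p] lies outside the disk, a radius that avoids the disk. *)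
Lemma tame_bounded_below r h : (0 <= r)%R -> tame r h ->
  (forall z, (Cmod z <= r)%R -> h z <> 0) ->
  exists c, (0 < c)%R /\ forall z, (Cmod z <= r)%R -> (c <= Cmod (h z))%R.
Proof.
  intros Hr [K H] Hnz.
  pose proof (tame_by_nonneg K r h Hr H) as HK.
  assert (Hd : forall u v : R, exists d : posreal,
    ((Cmod (u, v) <= r)%R /\ (d * (2 * (K + 1)) = Cmod (h (u, v)))%R) \/
    (r + 2 * d = Cmod (u, v))%R).
  { intros u v. destruct (Rle_lt_dec (Cmod (u, v)) r) as [Hle|Hlt].
    - assert (Hp : (0 < Cmod (h (u, v)) / (2 * (K + 1)))%R).
      { apply Rdiv_lt_0_compat; [|lra]. now apply Cmod_gt_0, Hnz. }
      exists (mkposreal _ Hp). left. split; [easy|]. simpl. field. lra.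
    - assert (Hp : (0 < (Cmod (u, v) - r) / 2)%R) by lra.
      exists (mkposreal _ Hp). right. simpl. lra. }
  destruct (functional_choice
    (fun (p : R * R) (d : posreal) =>
      ((Cmod p <= r)%R /\ (d * (2 * (K + 1)) = Cmod (h p))%R) \/
      (r + 2 * d = Cmod p)%R)) as [delta Hdelta].
  { intros [u v]. apply Hd. }
  destruct (compactness_value_2d (-r) r (-r) r (fun u v => delta (u, v)))
    as [d Hcomp].
  exists (2 * d)%R. split; [pose proof (cond_pos d); lra|].
  intros z Hz. destruct (Rle_lt_dec (2 * d) (Cmod (h z))) as [|Hlt]; [easy|].
  exfalso. destruct z as [x y].
  assert (Hxy : (Rabs x <= r /\ Rabs y <= r)%R).
  { pose proof (Rmax_Cmod (x, y)) as HM. simpl in HM.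
    pose proof (Rmax_l (Rabs x) (Rabs y)). pose proof (Rmax_r (Rabs x) (Rabs y)).
    lra. }
  apply (Hcomp x y); [apply Rabs_le_between; easy..|].
  intros (u & v & _ & _ & Hu & Hv & Hduv).
  assert (HD : (Cmod ((x, y) - (u, v)) < 2 * delta (u, v))%R).
  { replace ((x, y) - (u, v)) with (RtoC (x - u) + Ci * RtoC (y - v)).
    - eapply Rle_lt_trans; [apply Cmod_triangle|].
      rewrite Cmod_mult, Cmod_Ci, !Cmod_R. lra.
    - apply injective_projections; simpl; ring. }
  destruct (Hdelta (u, v)) as [[Hle E]|E].
  - destruct (H (x, y) (x, y) (u, v) Hz Hz Hle) as (_ & HL & _).
    assert (Htri : (Cmod (h (u, v)) <= Cmod (h (x, y)) + Cmod (h (x, y) - h (u, v)))%R).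
    { replace (h (u, v)) with (h (x, y) + - (h (x, y) - h (u, v))) at 1 by ring.
      eapply Rle_trans; [apply Cmod_triangle|]. rewrite Cmod_opp. lra. }
    assert (HL' : (K * Cmod ((x, y) - (u, v)) <= K * (2 * delta (u, v)))%R)
      by (apply Rmult_le_compat_l; lra).
    lra.
  - assert (Htri : (Cmod (u, v) <= Cmod (x, y) + Cmod ((x, y) - (u, v)))%R).
    { replace (u, v) with ((x, y) + - ((x, y) - (u, v))) at 1 by ring.
      eapply Rle_trans; [apply Cmod_triangle|]. rewrite Cmod_opp. lra. }
    lra.
Qed.

(** * The mean value property on regular polygons *)

(** The root of unity [exp (2 i pi / N)]. *)
Definition unit_root (N : nat) : C :=
  (cos (2 * PI / INR N), sin (2 * PI / INR N)).

Lemma cos_sin_pow t n : (cos t, sin t) ^ n = (cos (INR n * t), sin (INR n * t)).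
Proof.
  induction n as [|n IH].
  - simpl. rewrite Rmult_0_l, cos_0, sin_0. easy.
  - rewrite Cpow_S, IH, S_INR, Rmult_plus_distr_r, Rmult_1_l, cos_plus, sin_plus.
    apply injective_projections; simpl; ring.
Qed.

Lemma unit_root_pow_self N : (0 < N)%nat -> unit_root N ^ N = 1.
Proof.
  intros HN. unfold unit_root. rewrite cos_sin_pow.
  replace (INR N * (2 * PI / INR N))%R with (2 * PI)%R.
  - now rewrite cos_2PI, sin_2PI.
  - field. apply not_0_INR; lia.
Qed.

Lemma Cmod_unit_root_pow N k : Cmod (unit_root N ^ k) = 1%R.
Proof.
  unfold unit_root. rewrite cos_sin_pow. set (t := (INR k * (2 * PI / INR N))%R).
  unfold Cmod; simpl fst; simpl snd.
  pose proof (sin2_cos2 t) as E. unfold Rsqr in E.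
  replace (cos t ^ 2 + sin t ^ 2)%R with 1%R by (simpl; lra). apply sqrt_1.
Qed.

Lemma unit_root_neq_1 N : (2 < N)%nat -> unit_root N <> 1.
Proof.
  intros HN E. apply (f_equal snd) in E. simpl in E.
  assert (H2 : (2 < INR N)%R) by (apply lt_INR in HN; simpl in HN; lra).
  pose proof PI_RGT_0.
  assert (H3 : (0 < sin (2 * PI / INR N))%R).
  { apply sin_gt_0.
    - apply Rdiv_lt_0_compat; lra.
    - apply (Rmult_lt_reg_r (INR N)); [lra|].
      replace (2 * PI / INR N * INR N)%R with (2 * PI)%R by (field; lra). nra. }
  lra.
Qed.

(** The constant: with [t = 2 PI / N <= 8 / N], both coordinates of the difference
    are at most [t]. *)
Lemma Cmod_unit_root_minus_1 N : (2 < N)%nat ->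
  (Cmod (unit_root N - 1) <= 16 / INR N)%R.
Proof.
  intros HN.
  assert (H2 : (2 < INR N)%R) by (apply lt_INR in HN; simpl in HN; lra).
  unfold unit_root. set (t := (2 * PI / INR N)%R).
  pose proof PI_RGT_0 as HPI. pose proof PI_4 as HPI4.
  assert (Ht : (0 < t)%R) by (apply Rdiv_lt_0_compat; lra).
  assert (Ht4 : (2 * t <= 16 / INR N)%R).
  { unfold t. replace (2 * (2 * PI / INR N))%R with (4 * PI * / INR N)%R by (field; lra).
    apply Rmult_le_compat_r; [apply Rlt_le, Rinv_0_lt_compat|]; lra. }
  replace ((cos t, sin t) - 1) with (RtoC (cos t - 1) + Ci * RtoC (sin t))
    by (apply injective_projections; simpl; ring).
  eapply Rle_trans; [apply Cmod_triangle|].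
  rewrite Cmod_mult, Cmod_Ci, !Cmod_R.
  assert (Hs : forall u, (0 <= u)%R -> (Rabs (sin u) <= u)%R).
  { intros u Hu. destruct (Rle_lt_dec u 1) as [H1|H1].
    - pose proof PI2_3_2. unfold PI2 in *.
      rewrite Rabs_pos_eq; [|apply sin_ge_0; lra].
      destruct Hu as [Hu|<-]; [apply Rlt_le, sin_lt_x; lra|rewrite sin_0; lra].
    - pose proof (SIN_bound u). apply Rabs_le. lra. }
  assert (Hc : (Rabs (cos t - 1) <= t)%R).
  { replace t with (2 * (t / 2))%R at 1 by field. rewrite cos_2a_sin.
    replace (1 - 2 * sin (t / 2) * sin (t / 2) - 1)%R
      with (- (2 * (sin (t / 2) * sin (t / 2))))%R by ring.
    rewrite Rabs_Ropp, !Rabs_mult, (Rabs_pos_eq 2) by lra.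
    pose proof (Hs (t / 2)%R ltac:(lra)) as A.
    assert (B : (Rabs (sin (t / 2)) <= 1)%R)
      by (pose proof (SIN_bound (t / 2)); apply Rabs_le; lra).
    pose proof (Rabs_pos (sin (t / 2))). nra. }
  pose proof (Hs t ltac:(lra)). lra.
Qed.

(** Sum of [h] over the regular [N]-gon inscribed in the circle of radius [s]. *)
Definition ring_sum (h : C -> C) (N : nat) (s : R) : C :=
  Csum (fun j => h (s * unit_root N ^ j)) N.

(** Changing the radius moves every vertex [z] by a fixed multiple of its
    displacement to the next vertex. Up to a second divided difference, the
    increment of [h] is thus the same multiple of its increment along the
    polygon, and the latter increments sum to zero. *)
Lemma ring_sum_step K r h N s s' : (2 < N)%nat -> tame_by K r h ->
  (0 < s <= r)%R -> (0 <= s' <= r)%R ->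
  (Cmod (ring_sum h N s' - ring_sum h N s)
   <= INR N * (K * (Rabs (s' - s) * (Rabs (s' - s) + s * (16 / INR N)))))%R.
Proof.
  intros HN H Hs Hs'.
  assert (HK : (0 <= K)%R) by (apply (tame_by_nonneg K r h); [lra|easy]).
  set (w := unit_root N). set (p := fun j => w ^ j).
  assert (Hw0 : (0 < Cmod (w - 1))%R).
  { apply Cmod_gt_0. intros E. apply (unit_root_neq_1 N HN). fold w.
    replace w with (w - 1 + 1) by ring. rewrite E; ring. }
  assert (Hw1 : (Cmod (w - 1) <= 16 / INR N)%R) by now apply Cmod_unit_root_minus_1.
  assert (Hin : forall u j, (0 <= u <= r)%R -> (Cmod (RtoC u * p j) <= r)%R).
  { intros u j Hu. unfold p, w. rewrite Cmod_mult, Cmod_unit_root_pow, Cmod_R,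
      Rabs_pos_eq; lra. }
  (* The increments along the closed polygon telescope to zero. *)
  assert (Htel : Csum (fun j => h (s * p (S j)) - h (s * p j)) N = 0).
  { assert (T : forall n, Csum (fun j => h (s * p (S j)) - h (s * p j)) n
                  = h (s * p n) - h (s * p O)).
    { induction n as [|n IH]; simpl Csum; [|rewrite IH]; ring. }
    rewrite T. unfold p, w. rewrite unit_root_pow_self by lia. simpl. ring. }
  assert (E : RtoC s * (w - 1) * (ring_sum h N s' - ring_sum h N s) =
    Csum (fun j => RtoC s * (w - 1) * (h (s' * p j) - h (s * p j))
               - RtoC (s' - s) * (h (s * p (S j)) - h (s * p j))) N).
  { transitivity (RtoC s * (w - 1) * Csum (fun j => h (s' * p j) - h (s * p j)) N
      + - RtoC (s' - s) * Csum (fun j => h (s * p (S j)) - h (s * p j)) N).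
    - rewrite Htel. unfold ring_sum. fold w.
      rewrite (Csum_ext (fun j => h (s' * p j) - h (s * p j))
        (fun j => h (s' * p j) + (-1) * h (s * p j))) by (intros; ring).
      rewrite Csum_plus, Csum_scal. unfold p. ring.
    - rewrite <- !Csum_scal, <- Csum_plus. apply Csum_ext; intros; ring. }
  set (D := Cmod (ring_sum h N s' - ring_sum h N s)) in *.
  assert (Hsw : (0 < s * Cmod (w - 1))%R) by (apply Rmult_lt_0_compat; lra).
  (* Up to the rotation p j, s (w - 1) is the displacement to the next vertex. *)
  apply (Rmult_le_reg_l (s * Cmod (w - 1))); [easy|].
  assert (E1 : (s * Cmod (w - 1) * D)%R
    = Cmod (RtoC s * (w - 1) * (ring_sum h N s' - ring_sum h N s))).
  { rewrite !Cmod_mult, Cmod_R, Rabs_pos_eq by lra. easy. }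
  rewrite E1, E. eapply Rle_trans; [apply Cmod_Csum|].
  rewrite (Rmult_comm (INR N)), <- Rmult_assoc, (Rmult_comm _ (INR N)).
  rewrite <- Rsum_const. apply Rsum_le. intros j _.
  destruct (H (RtoC s' * p j) (RtoC s * p (S j)) (RtoC s * p j)) as (_ & _ & HT);
    [apply Hin; lra..|].
  assert (Ez : RtoC s * p (S j) - RtoC s * p j = p j * (RtoC s * (w - 1)))
    by (unfold p; simpl; ring).
  assert (Ex : RtoC s' * p j - RtoC s * p j = p j * RtoC (s' - s))
    by (rewrite RtoC_minus; ring).
  assert (Exy : RtoC s' * p j - RtoC s * p (S j)
    = p j * (RtoC (s' - s) + - (RtoC s * (w - 1))))
    by (unfold p; simpl; rewrite RtoC_minus; ring).
  rewrite Ez, Ex, Exy in HT.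
  match type of HT with (Cmod ?t <= _)%R => replace t with
    (p j * (RtoC s * (w - 1) * (h (s' * p j) - h (s * p j))
     - RtoC (s' - s) * (h (s * p (S j)) - h (s * p j)))) in HT by ring end.
  assert (Hpj : Cmod (p j) = 1%R) by apply Cmod_unit_root_pow.
  rewrite !(Cmod_mult (p j)), Hpj, !Rmult_1_l in HT.
  eapply Rle_trans; [exact HT|].
  rewrite !Cmod_mult, !Cmod_R, (Rabs_pos_eq s) by lra.
  rewrite <- (Rmult_assoc (s * Cmod (w - 1)) K), (Rmult_comm _ K), (Rmult_assoc K).
  apply Rmult_le_compat_l; [easy|].
  rewrite (Rmult_comm (Rabs (s' - s))), (Rmult_assoc (s * Cmod (w - 1))).
  apply Rmult_le_compat_l; [lra|]. apply Rmult_le_compat_l; [apply Rabs_pos|].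
  eapply Rle_trans; [apply Cmod_triangle|].
  rewrite Cmod_opp, Cmod_mult, !Cmod_R, (Rabs_pos_eq s) by lra.
  apply Rplus_le_compat_l, Rmult_le_compat_l; lra.
Qed.

(** The radius goes from [r / N] to [r] in steps of [r / N], each costing
    [O(1 / N)]; at radius [r / N] the Lipschitz bound compares with [h 0]. *)
Lemma ring_sum_center K r h N : (2 < N)%nat -> tame_by K r h -> (0 < r)%R ->
  (Cmod (ring_sum h N r - INR N * h 0) <= 17 * K * r ^ 2 + K * r)%R.
Proof.
  intros HN H Hr.
  assert (HK : (0 <= K)%R) by (apply (tame_by_nonneg K r h); [lra|easy]).
  assert (HN0 : (2 < INR N)%R) by (apply lt_INR in HN; simpl in HN; lra).
  assert (HiN : (0 < / INR N)%R) by (apply Rinv_0_lt_compat; lra).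
  assert (Claim : forall i, (i < N)%nat ->
    (Cmod (ring_sum h N (r * INR (S i) / INR N) - INR N * h 0)
      <= INR i * (17 * K * r ^ 2 / INR N) + K * r)%R).
  { induction i as [|i IH]; intros Hi.
    - rewrite Rmult_0_l, Rplus_0_l. simpl INR. rewrite Rmult_1_r.
      replace (ring_sum h N (r / INR N) - INR N * h 0) with
        (Csum (fun j => h (RtoC (r / INR N) * unit_root N ^ j) - h 0) N).
      + eapply Rle_trans; [apply Cmod_Csum|].
        replace (K * r)%R with (INR N * (K * (r / INR N)))%R by (field; lra).
        rewrite <- Rsum_const. apply Rsum_le. intros j _.
        set (z := RtoC (r / INR N) * unit_root N ^ j).
        assert (Hz : Cmod z = (r / INR N)%R).
        { unfold z. rewrite Cmod_mult, Cmod_unit_root_pow, Cmod_R, Rabs_pos_eq; [ring|].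
          apply Rdiv_le_0_compat; lra. }
        assert (Hzr : (Cmod z <= r)%R).
        { rewrite Hz. unfold Rdiv. rewrite <- (Rmult_1_r r) at 2.
          apply Rmult_le_compat_l; [lra|]. rewrite <- Rinv_1.
          apply Rinv_le_contravar; lra. }
        assert (H0 : (Cmod 0 <= r)%R) by (rewrite Cmod_0; lra).
        destruct (H z z 0 Hzr Hzr H0) as (_ & HL & _).
        replace (z - 0) with z in HL by ring. now rewrite Hz in HL.
      + unfold ring_sum. assert (T : forall c (u : nat -> C) n,
          Csum (fun j => u j - c) n = Csum u n - INR n * c).
        { intros c u. induction n as [|n IHn].
          - simpl. ring.
          - rewrite S_INR, RtoC_plus; simpl; rewrite IHn; ring. }
        apply T.
    - specialize (IH ltac:(lia)).
      assert (HiN1 : (INR (S i) <= INR N)%R) by (apply le_INR; lia).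
      assert (HiN2 : (INR (S (S i)) <= INR N)%R) by (apply le_INR; lia).
      pose proof (pos_INR i) as Hi0.
      assert (Hfrac : forall x, (0 <= x <= INR N)%R -> (0 <= r * x / INR N <= r)%R).
      { intros x Hx. split.
        - apply Rdiv_le_0_compat; [apply Rmult_le_pos|]; lra.
        - apply (Rmult_le_reg_r (INR N)); [lra|].
          replace (r * x / INR N * INR N)%R with (r * x)%R by (field; lra).
          apply Rmult_le_compat_l; lra. }
      set (s := (r * INR (S i) / INR N)%R) in *.
      set (s' := (r * INR (S (S i)) / INR N)%R) in *.
      assert (Hs : (0 < s <= r)%R).
      { split; [|apply Hfrac; split; [apply pos_INR|easy]].
        apply Rdiv_lt_0_compat; [|lra]. apply Rmult_lt_0_compat; [lra|].
        apply lt_0_INR; lia. }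
      assert (Hs' : (0 <= s' <= r)%R) by (apply Hfrac; split; [apply pos_INR|easy]).
      pose proof (ring_sum_step K r h N s s' HN H Hs Hs') as HS.
      assert (Ed : (s' - s = r / INR N)%R)
        by (unfold s, s'; rewrite !S_INR; field; lra).
      rewrite Ed, Rabs_pos_eq in HS by (apply Rdiv_le_0_compat; lra).
      assert (HB : (INR N * (K * (r / INR N * (r / INR N + s * (16 / INR N))))
                    <= 17 * K * r ^ 2 / INR N)%R).
      { replace (17 * K * r ^ 2 / INR N)%R with
          (INR N * (K * (r / INR N * (r / INR N + r * (16 / INR N)))))%R
          by (field; lra).
        apply Rmult_le_compat_l; [lra|]. apply Rmult_le_compat_l; [lra|].
        apply Rmult_le_compat_l; [apply Rdiv_le_0_compat; lra|].
        apply Rplus_le_compat_l, Rmult_le_compat_r; [apply Rdiv_le_0_compat|]; lra. }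
      replace (ring_sum h N s' - INR N * h 0) with
        ((ring_sum h N s' - ring_sum h N s) + (ring_sum h N s - INR N * h 0)) by ring.
      eapply Rle_trans; [apply Cmod_triangle|].
      rewrite S_INR, Rmult_plus_distr_r. lra. }
  destruct N as [|n]; [lia|]. specialize (Claim n ltac:(lia)).
  replace (r * INR (S n) / INR (S n))%R with r in Claim by (field; lra).
  eapply Rle_trans; [exact Claim|].
  apply Rplus_le_compat_r.
  replace (INR n * (17 * K * r ^ 2 / INR (S n)))%R with
    (17 * K * r ^ 2 * (INR n / INR (S n)))%R by (field; lra).
  rewrite <- (Rmult_1_r (17 * K * r ^ 2)) at 2. apply Rmult_le_compat_l.
  - repeat apply Rmult_le_pos; try lra; simpl; repeat apply Rmult_le_pos; lra.
  - apply (Rmult_le_reg_r (INR (S n))); [lra|].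
    replace (INR n / INR (S n) * INR (S n))%R with (INR n) by (field; lra).
    rewrite S_INR. lra.
Qed.

(** Mean of [u] over the regular polygon with [n + 3] vertices in the circle of
    radius [r]; three vertices at least make the root of unity non-real. *)
Definition circle_mean (r : R) (u : C -> R) (n : nat) : R :=
  (Rsum (fun j => u (RtoC r * unit_root (n + 3) ^ j)%C) (n + 3) / INR (n + 3))%R.

Lemma circle_mean_le r u v n : (0 <= r)%R ->
  (forall z, Cmod z = r -> (u z <= v z)%R) ->
  (circle_mean r u n <= circle_mean r v n)%R.
Proof.
  intros Hr H. apply Rmult_le_compat_r.
  - apply Rlt_le, Rinv_0_lt_compat, lt_0_INR; lia.
  - apply Rsum_le. intros j _. apply H.
    rewrite Cmod_mult, Cmod_unit_root_pow, Cmod_R, Rabs_pos_eq; lra.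
Qed.

Lemma circle_mean_ext r u v n : (0 <= r)%R ->
  (forall z, Cmod z = r -> u z = v z) -> circle_mean r u n = circle_mean r v n.
Proof.
  intros Hr H. apply Rle_antisym; apply circle_mean_le; auto;
    intros z Hz; rewrite (H z Hz); lra.
Qed.

Lemma circle_mean_plus r u v n :
  circle_mean r (fun z => u z + v z)%R n = (circle_mean r u n + circle_mean r v n)%R.
Proof. unfold circle_mean, Rdiv. rewrite Rsum_plus. ring. Qed.

Lemma circle_mean_scal r c u n :
  circle_mean r (fun z => c * u z)%R n = (c * circle_mean r u n)%R.
Proof. unfold circle_mean, Rdiv. rewrite Rsum_scal. ring. Qed.

Lemma circle_mean_const r c n : circle_mean r (fun _ => c) n = c.
Proof.
  unfold circle_mean. rewrite Rsum_const. field. apply not_0_INR; lia.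
Qed.

(** Mean value property: the polygonal means converge to the central value. *)
Lemma circle_mean_value r h : (0 < r)%R -> tame r h ->
  is_lim_seq (circle_mean r (fun z => Re (h z))) (Re (h 0)).
Proof.
  intros Hr [K H]. set (B := (17 * K * r ^ 2 + K * r)%R).
  assert (Hb : forall n, (Rabs (circle_mean r (fun z => Re (h z)) n - Re (h 0))
                <= B * / INR (n + 3))%R).
  { intros n. assert (HN : (0 < INR (n + 3))%R) by (apply lt_0_INR; lia).
    pose proof (ring_sum_center K r h (n + 3) ltac:(lia) H Hr) as HC.
    unfold circle_mean. rewrite <- (Re_Csum (fun j => h (r * unit_root (n + 3) ^ j))).
    fold (ring_sum h (n + 3) r). set (S := ring_sum h (n + 3) r) in *.
    assert (E : (Re S / INR (n + 3) - Re (h 0))%R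
      = (Re (S - INR (n + 3) * h 0) * / INR (n + 3))%R)
      by (unfold Re; simpl; field; lra).
    rewrite E, Rabs_mult, (Rabs_pos_eq (/ _))
      by now apply Rlt_le, Rinv_0_lt_compat.
    apply Rmult_le_compat_r; [now apply Rlt_le, Rinv_0_lt_compat|].
    eapply Rle_trans; [apply re_le_Cmod|exact HC]. }
  assert (HL : is_lim_seq (fun n => B * / INR (n + 3))%R 0%R).
  { replace (Finite 0) with (Rbar_mult B 0) by (simpl; f_equal; ring).
    apply is_lim_seq_scal_l.
    apply (is_lim_seq_inv _ p_infty); [|easy].
    apply (is_lim_seq_incr_n INR 3). apply is_lim_seq_INR. }
  assert (HD : is_lim_seq (fun n => circle_mean r (fun z => Re (h z)) n - Re (h 0))%R 0%R).
  { apply is_lim_seq_abs_0.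
    refine (is_lim_seq_le_le (fun _ => 0%R) _ _ 0%R _ (is_lim_seq_const 0) HL).
    intros n; split; [apply Rabs_pos|apply Hb]. }
  apply (is_lim_seq_ext (fun n => circle_mean r (fun z => Re (h z)) n - Re (h 0)
           + Re (h 0))%R); [intros; ring|].
  replace (Finite (Re (h 0))) with (Finite (0 + Re (h 0))) by (f_equal; ring).
  apply is_lim_seq_plus'; [exact HD|apply is_lim_seq_const].
Qed.

(** * Parseval and coefficient sums of bounded quotients *)

(** The polynomial of degree less than [m] with coefficients [c]. *)
Definition trunc (c : nat -> C) (m : nat) (z : C) : C :=
  Csum (fun k => c k * z ^ k) m.

(** On [|z| = r], [Cconj z ^ k * z ^ m = (r ^ 2) ^ k * z ^ (m - k)], so the
    integrand agrees with a function tame on the disk and vanishing at [0]. *)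
Lemma circle_mean_cross r c m X : (0 < r < 1)%R -> tame r X ->
  is_lim_seq (circle_mean r (fun z => Re (Cconj (trunc c m z) * (z ^ m * X z)))) 0%R.
Proof.
  intros Hr HX.
  set (H := fun z => Csum (fun k => Cconj (c k) * RtoC (r ^ 2) ^ k * z ^ (m - k)) m * X z).
  assert (H0 : H 0 = 0).
  { unfold H. rewrite (Csum_ext _ (fun k => 0 * 0)).
    - rewrite Csum_scal. ring.
    - intros k Hk. replace (m - k)%nat with (S (m - k - 1)) by lia. simpl. ring. }
  apply (is_lim_seq_ext (circle_mean r (fun z => Re (H z)))).
  - intros n. apply circle_mean_ext; [lra|]. intros z Hz. f_equal.
    unfold H, trunc. rewrite Csum_conj, Cmult_assoc. f_equal.
    rewrite (Cmult_comm _ (z ^ m)), <- Csum_scal. apply Csum_ext. intros k Hk.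
    rewrite Cmult_conj, Cpow_conj.
    rewrite <- Hz, <- (Cpow_conj z k), Cpow_conj.
    assert (E : RtoC (Cmod z ^ 2) = z * Cconj z) by apply Cmod2_conj.
    rewrite E, Cpow_mult_l.
    replace m with (k + (m - k))%nat at 2 by lia. rewrite Cpow_add_r. ring.
  - replace (Finite 0) with (Finite (Re (H 0))) by (now rewrite H0).
    apply circle_mean_value; [lra|]. unfold H. apply tame_mult; [|exact HX].
    apply tame_Csum. intros k _. apply tame_scal, tame_pow. lra.
Qed.

Lemma Cmod_plus_sqr x y :
  (Cmod (x + y) ^ 2 = Cmod x ^ 2 + Cmod y ^ 2 + 2 * Re (Cconj x * y))%R.
Proof. rewrite !Cmod2_alt. destruct x, y; simpl. ring. Qed.

Lemma circle_mean_parseval r c m : (0 < r < 1)%R ->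
  is_lim_seq (circle_mean r (fun z => Cmod (trunc c m z) ^ 2)%R)
    (Rsum (fun k => Cmod (c k) ^ 2 * (r ^ 2) ^ k)%R m).
Proof.
  intros Hr. induction m as [|m IH].
  - apply (is_lim_seq_ext (fun _ => 0%R)); [|apply is_lim_seq_const].
    intros n. rewrite <- (circle_mean_const r 0 n). apply circle_mean_ext; [lra|].
    intros z _. unfold trunc; simpl. rewrite Cmod_0. ring.
  - apply (is_lim_seq_ext (fun n =>
      circle_mean r (fun z => Cmod (trunc c m z) ^ 2)%R n
      + Cmod (c m) ^ 2 * (r ^ 2) ^ m
      + 2 * circle_mean r (fun z => Re (Cconj (trunc c m z) * (z ^ m * c m))) n)%R).
    + intros n. rewrite <- circle_mean_scal.
      rewrite <- (circle_mean_const r (Cmod (c m) ^ 2 * (r ^ 2) ^ m) n) at 1.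
      rewrite <- !circle_mean_plus. apply circle_mean_ext; [lra|].
      intros z Hz. change (trunc c (S m) z) with (trunc c m z + c m * z ^ m).
      rewrite Cmod_plus_sqr, (Cmult_comm (z ^ m)), Cmod_mult, Cmod_pow, Hz.
      rewrite Rpow_mult_distr, <- !pow_mult, (Nat.mul_comm m). ring.
    + replace (Rsum _ (S m)) with
        (Rsum (fun k => Cmod (c k) ^ 2 * (r ^ 2) ^ k) m
         + Cmod (c m) ^ 2 * (r ^ 2) ^ m + 2 * 0)%R by (simpl; ring).
      apply is_lim_seq_plus'; [apply is_lim_seq_plus'; [exact IH|apply is_lim_seq_const]|].
      apply (is_lim_seq_scal_l _ 2 0%R). apply circle_mean_cross; [easy|].
      apply (tame_ext r (fun z => c m * z ^ 0)); [intros; simpl; ring|].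
      apply tame_scal, tame_pow. lra.
Qed.

Lemma le_of_le_mult_pow S T p : (0 <= S)%R ->
  (forall r, (0 < r < 1)%R -> (r ^ p * S <= T)%R) -> (S <= T)%R.
Proof.
  intros HS H.
  set (r := fun n : nat => (1 - / (INR n + 2))%R).
  assert (Hr : forall n, (0 < r n < 1)%R).
  { intros n. pose proof (pos_INR n). unfold r.
    assert (0 < / (INR n + 2))%R by (apply Rinv_0_lt_compat; lra).
    assert (/ (INR n + 2) <= / 2)%R by (apply Rinv_le_contravar; lra). lra. }
  assert (L1 : is_lim_seq r 1%R).
  { unfold r. replace (Finite 1) with (Finite (1 - 0)) by (f_equal; ring).
    apply is_lim_seq_minus'; [apply is_lim_seq_const|].
    apply (is_lim_seq_inv _ p_infty); [|easy].
    apply (is_lim_seq_plus _ _ p_infty 2%R); [apply is_lim_seq_INR|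
      apply is_lim_seq_const|easy]. }
  assert (L2 : forall q, is_lim_seq (fun n => r n ^ q)%R 1%R).
  { induction q as [|q IH]; simpl; [apply is_lim_seq_const|].
    replace (Finite 1) with (Finite (1 * 1)) by (f_equal; ring).
    now apply is_lim_seq_mult'. }
  refine (is_lim_seq_le (fun n => r n ^ p * S)%R (fun _ => T) S T _ _ (is_lim_seq_const T)).
  - intros n. now apply H.
  - replace S with (1 * S)%R at 1 by ring.
    apply is_lim_seq_mult'; [apply L2|apply is_lim_seq_const].
Qed.

(** Truncations satisfy the same coefficient inequality as the full series:
    [gam * trunc cf m z / phi] equals [trunc cg m z] plus [z ^ m * X z], where
    [X] has no singularity in the disk, so the second term is orthogonal to the
    first on circles. *)
Lemma bounded_quotient_coef_sums cf cg phi gam m :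
  disk_expansion cf phi -> disk_expansion cg gam ->
  (forall z, (Cmod z < 1)%R -> phi z <> 0) ->
  (forall z, (Cmod z < 1)%R -> z <> 0 -> (Cmod (z * gam z) <= Cmod (phi z))%R) ->
  (Rsum (fun k => Cmod (cg k) ^ 2) m <= Rsum (fun k => Cmod (cf k) ^ 2) m)%R.
Proof.
  intros Hphi Hgam Hnz Hle.
  destruct (disk_expansion_tail _ _ m Hphi) as [phi1 [Hphi1 Ephi]].
  destruct (disk_expansion_tail _ _ m Hgam) as [gam1 [Hgam1 Egam]].
  assert (Hpos : forall c : nat -> C, (0 <= Rsum (fun k => Cmod (c k) ^ 2) m)%R).
  { intros c. replace 0%R with (Rsum (fun _ => 0%R) m)
      by (rewrite Rsum_const; ring).
    apply Rsum_le. intros k _. apply pow2_ge_0. }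
  (* A factor r ^ 2 comes from |gam / phi| <= 1 / r on the circle, and the weights
     (r ^ 2) ^ k of Parseval's formula are at least r ^ (2 m). *)
  apply (le_of_le_mult_pow _ _ (2 * m + 2)); [apply Hpos|].
  intros r Hr.
  set (X := fun z => gam1 z + (-1) * (gam z * phi1 z * / phi z)).
  assert (Hphit : tame r phi) by (apply (disk_expansion_tame _ _ _ Hphi); lra).
  assert (HX : tame r X).
  { destruct (tame_bounded_below r phi ltac:(lra) Hphit) as [c [Hc Hlow]].
    { intros z Hz. apply Hnz. lra. }
    apply tame_plus; [apply (disk_expansion_tame _ _ _ Hgam1); lra|].
    apply tame_scal, tame_mult; [apply tame_mult|].
    - apply (disk_expansion_tame _ _ _ Hgam); lra.
    - apply (disk_expansion_tame _ _ _ Hphi1); lra.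
    - now apply (tame_inv r phi c). }
  assert (Hpt : forall z, Cmod z = r ->
    (r ^ 2 * (Cmod (trunc cg m z) ^ 2
       + 2 * Re (Cconj (trunc cg m z) * (z ^ m * X z)))
     <= Cmod (trunc cf m z) ^ 2)%R).
  { intros z Hz. assert (Hz1 : (Cmod z < 1)%R) by lra.
    assert (Hz0 : z <> 0) by (intros ->; rewrite Cmod_0 in Hz; lra).
    pose proof (Hnz z Hz1) as Hp.
    assert (E : (trunc cg m z + z ^ m * X z) * phi z = gam z * trunc cf m z).
    { transitivity ((trunc cg m z + z ^ m * gam1 z) * phi z - z ^ m * gam z * phi1 z).
      - unfold X. field. exact Hp.
      - unfold trunc at 1. rewrite <- Egam by easy. rewrite (Ephi z Hz1) at 1.
        unfold trunc. ring. }
    apply (f_equal Cmod) in E. rewrite !Cmod_mult in E.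
    pose proof (Hle z Hz1 Hz0) as HL. rewrite Cmod_mult, Hz in HL.
    assert (Hp0 : (0 < Cmod (phi z))%R) by now apply Cmod_gt_0.
    assert (HV : (r * Cmod (trunc cg m z + z ^ m * X z) <= Cmod (trunc cf m z))%R).
    { apply (Rmult_le_reg_r (Cmod (phi z))); [easy|].
      rewrite Rmult_assoc, E, <- Rmult_assoc, (Rmult_comm (Cmod (trunc cf m z))).
      apply Rmult_le_compat_r; [apply Cmod_ge_0|easy]. }
    pose proof (Cmod_plus_sqr (trunc cg m z) (z ^ m * X z)) as ES.
    assert (HV2 : ((r * Cmod (trunc cg m z + z ^ m * X z)) ^ 2
                   <= Cmod (trunc cf m z) ^ 2)%R).
    { apply pow_incr. split; [|easy].
      apply Rmult_le_pos; [lra|apply Cmod_ge_0]. }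
    rewrite Rpow_mult_distr, ES in HV2.
    pose proof (pow2_ge_0 (Cmod (z ^ m * X z))) as HQ.
    pose proof (pow2_ge_0 r).
    eapply Rle_trans; [|exact HV2]. apply Rmult_le_compat_l; lra. }
  assert (Hmean : (r ^ 2 * Rsum (fun k => Cmod (cg k) ^ 2 * (r ^ 2) ^ k) m
                   <= Rsum (fun k => Cmod (cf k) ^ 2 * (r ^ 2) ^ k) m)%R).
  { refine (is_lim_seq_le
      (fun n => r ^ 2 * (circle_mean r (fun z => Cmod (trunc cg m z) ^ 2)%R n
        + 2 * circle_mean r (fun z => Re (Cconj (trunc cg m z) * (z ^ m * X z))) n))%R
      (circle_mean r (fun z => Cmod (trunc cf m z) ^ 2)%R)
      (r ^ 2 * Rsum (fun k => Cmod (cg k) ^ 2 * (r ^ 2) ^ k) m)%R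
      (Rsum (fun k => Cmod (cf k) ^ 2 * (r ^ 2) ^ k)%R m) _ _
      (circle_mean_parseval r cf m Hr)).
    - intros n. rewrite <- circle_mean_scal, <- circle_mean_plus, <- circle_mean_scal.
      apply circle_mean_le; [lra|exact Hpt].
    - apply (is_lim_seq_scal_l _ (r ^ 2)
        (Rsum (fun k => Cmod (cg k) ^ 2 * (r ^ 2) ^ k)%R m)).
      replace (Rsum _ m) with
        (Rsum (fun k => Cmod (cg k) ^ 2 * (r ^ 2) ^ k) m + 2 * 0)%R by ring.
      apply is_lim_seq_plus'; [now apply circle_mean_parseval|].
      apply (is_lim_seq_scal_l _ 2 0%R). now apply circle_mean_cross. }
  assert (Hr2 : (0 <= r ^ 2 <= 1)%R) by (simpl; nra).
  eapply Rle_trans; [|eapply Rle_trans; [exact Hmean|]].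
  - rewrite pow_add, (Rmult_comm (r ^ _)), Rmult_assoc.
    apply Rmult_le_compat_l; [easy|]. rewrite pow_mult, <- Rsum_scal.
    apply Rsum_le. intros k Hk. rewrite Rmult_comm.
    apply Rmult_le_compat_l; [apply pow2_ge_0|].
    replace m with (k + (m - k))%nat by lia. rewrite pow_add.
    rewrite <- (Rmult_1_r ((r ^ 2) ^ k)) at 2.
    apply Rmult_le_compat_l; [now apply pow_le|].
    rewrite <- (pow1 (m - k)). now apply pow_incr.
  - apply Rsum_le. intros k _. rewrite <- (Rmult_1_r (Cmod (cf k) ^ 2)) at 2.
    apply Rmult_le_compat_l; [apply pow2_ge_0|].
    rewrite <- (pow1 k). now apply pow_incr.
Qed.

(** * The Taylor coefficients of the kernel *)

Lemma one_minus_neq_0 z : (Cmod z < 1)%R -> 1 - z <> 0.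
Proof.
  intros Hz E. assert (H : z = 1) by (replace z with (1 - (1 - z)) by ring; rewrite E; ring).
  rewrite H, Cmod_1 in Hz. lra.
Qed.

(** The expansion of [(1 - zeta z) (1 - z) K = z] is a two-term recurrence which
    the brackets also satisfy. *)
Lemma zkernel_coef zeta b : (Cmod zeta <= 1)%R ->
  disk_expansion b (zkernel zeta) -> forall n, b n = zbracket zeta n.
Proof.
  intros Hzeta Hb.
  pose proof (disk_expansion_mul_z _ _ Hb) as Hb1.
  pose proof (disk_expansion_mul_z _ _ Hb1) as Hb2.
  pose proof (disk_expansion_mul_z _ _ (disk_expansion_const 1)) as Hz.
  pose proof (disk_expansion_lin 1 zeta _ _ _ _
    (disk_expansion_lin 1 (- (1 + zeta)) _ _ _ _ Hb Hb1) Hb2) as HL.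
  pose proof (disk_expansion_unique _ _ _ _ HL Hz) as Hrec. simpl in Hrec.
  assert (E : forall z : C, (Cmod z < 1)%R -> z <> 0 ->
    1 * (1 * zkernel zeta z + - (1 + zeta) * (z * zkernel zeta z))
      + zeta * (z * (z * zkernel zeta z)) = z * 1).
  { intros z Hz1 _. unfold zkernel.
    assert (H1 : 1 - z <> 0) by now apply one_minus_neq_0.
    assert (H2 : 1 - zeta * z <> 0).
    { apply one_minus_neq_0. rewrite Cmod_mult.
      pose proof (Cmod_ge_0 z). pose proof (Cmod_ge_0 zeta). nra. }
    field. now split. }
  specialize (Hrec E).
  assert (H0 : b O = 0).
  { transitivity (1 * (1 * b O + - (1 + zeta) * 0) + zeta * 0); [ring|].
    now rewrite (Hrec O). }
  assert (H1 : b 1%nat = 1).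
  { transitivity (1 * (1 * b 1%nat + - (1 + zeta) * b O) + zeta * 0);
      [rewrite H0; ring|]. now rewrite (Hrec 1%nat). }
  assert (HH : forall n, b n = zbracket zeta n /\ b (S n) = zbracket zeta (S n)).
  { induction n as [|n [IH1 IH2]].
    - rewrite H0, H1. simpl. split; ring.
    - split; [exact IH2|].
      replace (b (S (S n))) with
        (1 * (1 * b (S (S n)) + - (1 + zeta) * b (S n)) + zeta * b n
         + (1 + zeta) * b (S n) - zeta * b n) by ring.
      rewrite (Hrec (S (S n))), IH1, IH2. simpl. ring. }
  intros n. apply HH.
Qed.

(** * The coefficient estimate *)

(** The bounds [p] are the solution of the case of equality in the inequalities
    between sums; since [B <= A] the recursion is monotone and [x <= p]. *)
Lemma clunie_recursion (A B x p : nat -> R) n :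
  B O = 0%R -> x O = p O ->
  (forall k, (B k <= A k)%R) ->
  (forall m, (Rsum (fun k => B (S k) * x (S k)) m <= Rsum (fun k => A k * x k) m)%R) ->
  (forall k, (k < n)%nat -> (0 < B (S k))%R /\ (B (S k) * p (S k) = A k * p k)%R) ->
  forall k, (k <= n)%nat -> (x k <= p k)%R.
Proof.
  intros HB0 H0 HBA Hsum Hp k. induction k as [k IH] using (well_founded_induction Nat.lt_wf_0).
  intros Hk. destruct k as [|m]; [rewrite H0; lra|].
  destruct (Hp m ltac:(lia)) as [HBpos _].
  apply (Rmult_le_reg_l (B (S m))); [easy|].
  assert (Htel : forall j, (j <= n)%nat ->
    Rsum (fun k => (A k - B k) * p k)%R j = (B j * p j)%R).
  { induction j as [|j IHj]; intros Hj; simpl; [rewrite HB0; ring|].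
    rewrite IHj by lia. destruct (Hp j ltac:(lia)) as [_ ->]. ring. }
  (* Equality in the recursion for p telescopes, which reduces the claim to a
     termwise comparison with nonnegative weights A k - B k. *)
  rewrite <- Htel by easy.
  apply Rle_trans with (Rsum (fun k => (A k - B k) * x k)%R (S m)).
  - assert (E : Rsum (fun k => A k * x k)%R (S m)
      = (Rsum (fun k => (A k - B k) * x k) (S m) + Rsum (fun k => B k * x k) (S m))%R).
    { rewrite <- Rsum_plus. apply Rsum_ext. intros; ring. }
    rewrite (Rsum_shift (fun k => B k * x k)%R), HB0 in E.
    specialize (Hsum (S m)). simpl Rsum at 1 in Hsum. lra.
  - apply Rsum_le. intros j Hj. apply Rmult_le_compat_l.
    + specialize (HBA j). lra.
    + apply IH; lia.
Qed.

Lemma fold_right_Rmult_seq_S (t : nat -> R) i k :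
  fold_right Rmult 1%R (map t (seq i (S k)))
  = (fold_right Rmult 1%R (map t (seq i k)) * t (i + k)%nat)%R.
Proof.
  rewrite seq_S, map_app, fold_right_app. simpl. rewrite Rmult_1_r.
  generalize (map t (seq i k)) as l. induction l as [|c l IH]; simpl; [ring|].
  rewrite IH. ring.
Qed.

(** Gives both [|p - 1| <= |p + 1 - 2 alpha|] when [alpha < Re p] and
    [alpha < 1], and the monotonicity [B <= A] of the recursion for [p] a bracket. *)
Lemma half_plane_Cmod2 alpha p :
  (Cmod (p + RtoC (1 - 2 * alpha)) ^ 2 - Cmod (p - 1) ^ 2
   = 4 * (1 - alpha) * (Re p - alpha))%R.
Proof. rewrite !Cmod2_alt. destruct p as [u v]. unfold Re, Im. simpl. ring. Qed.

(** Clunie's inequality, applied to the quotient of [z D f - f] by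
    [z D f + (1 - 2 alpha) f]; the two sums collect the powers [z ^ (k + 2)] and
    [z ^ (k + 1)] with [k < m]. *)
Lemma zstarlike_coef_sums alpha zeta f a :
  (alpha < 1)%R -> (Cmod zeta <= 1)%R ->
  zstarlike zeta alpha f -> normalized_expansion a f ->
  forall m,
    (Rsum (fun k => Cmod ((zbracket zeta (S (S k)) - 1) * a (S (S k))) ^ 2) m
     <= Rsum (fun k => Cmod ((zbracket zeta (S k) + RtoC (1 - 2 * alpha)) * a (S k)) ^ 2) m)%R.
Proof.
  intros Halpha Hzeta (_ & g & (_ & h & (a' & b & Ha' & Hb & Hh) & Hg) & Hq)
    (Ha0 & Ha1 & Ha) m.
  assert (Ea : forall n, a' n = a n) by now apply (disk_expansion_unique _ _ _ _ Ha' Ha).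
  pose proof (zkernel_coef zeta b Hzeta Hb) as Eb.
  set (beta := RtoC (1 - 2 * alpha)).
  assert (HF : disk_expansion (fun n => (zbracket zeta n + beta) * a n)
                 (fun z => h z + beta * f z)).
  { apply (disk_expansion_ext _ _ _ _) with (3 := disk_expansion_lin 1 beta _ _ _ _ Hh Ha).
    - intros n. rewrite Ea, Eb. ring.
    - intros z _. ring. }
  assert (HG : disk_expansion (fun n => (zbracket zeta n - 1) * a n)
                 (fun z => h z - f z)).
  { apply (disk_expansion_ext _ _ _ _) with (3 := disk_expansion_lin 1 (-1) _ _ _ _ Hh Ha).
    - intros n. rewrite Ea, Eb. ring.
    - intros z _. ring. }
  destruct (disk_expansion_shift _ _ HF) as [phi [Hphi Ephi]].
  destruct (disk_expansion_tail _ _ 2 HG) as [gam [Hgam Egam]].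
  assert (Hpt : forall z, (Cmod z < 1)%R -> z <> 0 -> exists p,
    f z <> 0 /\ (alpha < Re p)%R /\ z * phi z = f z * (p + beta) /\
    z * (z * gam z) = f z * (p - 1)).
  { intros z Hz Hz0. destruct (Hq z Hz) as [Hf0 Hre]. specialize (Hf0 Hz0).
    unfold starlike_quotient in Hre. destruct (Ceq_dec z 0) as [|_]; [easy|].
    exists (z * g z / f z). split; [easy|split; [easy|]].
    rewrite (Hg z Hz Hz0).
    specialize (Ephi z Hz). specialize (Egam z Hz). rewrite Ha0 in Ephi.
    simpl in Egam. rewrite Ha0, Ha1 in Egam. split.
    - transitivity (h z + beta * f z); [rewrite Ephi; ring|]. field. now split.
    - transitivity (h z - f z); [rewrite Egam; ring|]. field. now split. }
  apply (bounded_quotient_coef_sums _ _ phi gam m Hphi Hgam).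
  - intros z Hz E. destruct (Ceq_dec z 0) as [->|Hz0].
    + rewrite (disk_expansion_at_0 _ _ Hphi), Ha1 in E. simpl in E.
      apply (f_equal Re) in E. unfold beta, Re in E. simpl in E. lra.
    + destruct (Hpt z Hz Hz0) as (p & Hf0 & Hre & Ep & _).
      assert (E2 : p + beta = 0).
      { replace (p + beta) with (/ f z * (f z * (p + beta))) by (field; easy).
        rewrite <- Ep, E. ring. }
      apply (f_equal Re) in E2. unfold beta, Re in E2. simpl in E2. unfold Re in Hre. lra.
  - intros z Hz Hz0. destruct (Hpt z Hz Hz0) as (p & Hf0 & Hre & Ep & Eg).
    apply (Rmult_le_reg_l (Cmod z)); [now apply Cmod_gt_0|].
    rewrite <- !(Cmod_mult z), Ep, Eg, !Cmod_mult.
    apply Rmult_le_compat_l; [apply Cmod_ge_0|].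
    pose proof (half_plane_Cmod2 alpha p) as E. fold beta in E.
    assert (0 <= 4 * (1 - alpha) * (Re p - alpha))%R by (apply Rmult_le_pos; lra).
    apply Rsqr_incr_0_var; [|apply Cmod_ge_0].
    rewrite !Rsqr_pow2. lra.
Qed.

Theorem theorem5p3 (alpha : R) (zeta : C) (f : C -> C) (a : nat -> C)
    (halpha : (0 <= alpha < 1)%R)
    (hzeta : (Cmod zeta <= 1)%R)
    (hbracket : forall k : nat, (1 <= k)%nat -> (alpha < Re (zbracket zeta k))%R)
    (hf : zstarlike zeta alpha f)
    (ha : normalized_expansion a f) :
  forall n : nat, (2 <= n)%nat ->
    (forall k : nat, (2 <= k <= n)%nat -> zbracket zeta k <> RtoC 1) ->
    (Cmod (a n) <=
       fold_right Rmult 1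
         (map (fun k : nat =>
                 Cmod ((RtoC (1 - 2 * alpha) + zbracket zeta (k - 1))
                         / (zbracket zeta k - RtoC 1))%C)
              (seq 2 (n - 1))))%R.
Proof.
  intros n Hn Hne.
  set (t := fun k : nat => Cmod ((RtoC (1 - 2 * alpha) + zbracket zeta (k - 1))
                         / (zbracket zeta k - RtoC 1))).
  set (P := fun k => fold_right Rmult 1%R (map t (seq 2 k))).
  change (Cmod (a n) <= P (n - 1)%nat)%R.
  pose proof (zstarlike_coef_sums alpha zeta f a ltac:(lra) hzeta hf ha) as Hsum.
  destruct ha as (_ & Ha1 & _).
  assert (Hpos : forall k, (0 <= P k)%R).
  { induction k as [|k IH]; [unfold P; simpl; lra|]. unfold P. rewrite fold_right_Rmult_seq_S.
    apply Rmult_le_pos; [exact IH|apply Cmod_ge_0]. }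
  assert (Hx : forall k, (k <= n - 1)%nat -> (Cmod (a (S k)) ^ 2 <= P k ^ 2)%R).
  { apply (clunie_recursion
      (fun k => Cmod (zbracket zeta (S k) + RtoC (1 - 2 * alpha)) ^ 2)%R
      (fun k => Cmod (zbracket zeta (S k) - 1) ^ 2)%R
      (fun k => Cmod (a (S k)) ^ 2)%R (fun k => P k ^ 2)%R).
    - simpl. replace (0 + 1 - 1) with (RtoC 0) by ring. rewrite Cmod_0. ring.
    - rewrite Ha1, Cmod_1. unfold P. simpl. ring.
    - intros k. pose proof (half_plane_Cmod2 alpha (zbracket zeta (S k))) as E.
      specialize (hbracket (S k) ltac:(lia)).
      assert (0 <= 4 * (1 - alpha) * (Re (zbracket zeta (S k)) - alpha))%R
        by (apply Rmult_le_pos; lra).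
      lra.
    - intros m. eapply Rle_trans; [|eapply Rle_trans; [exact (Hsum m)|]];
        apply Req_le, Rsum_ext; intros k _; now rewrite Cmod_mult, Rpow_mult_distr.
    - intros k Hk.
      assert (Hd : zbracket zeta (S (S k)) - 1 <> 0).
      { intros E. apply (Hne (S (S k)) ltac:(lia)).
        replace (zbracket zeta (S (S k))) with (zbracket zeta (S (S k)) - 1 + 1) by ring.
        rewrite E. ring. }
      pose proof (proj1 (Cmod_gt_0 _) Hd) as Hd'.
      split; [now apply pow_lt|].
      unfold P. rewrite fold_right_Rmult_seq_S. fold (P k).
      unfold t. rewrite Cmod_div by exact Hd.
      replace (2 + k - 1)%nat with (S k) by lia. change (2 + k)%nat with (S (S k)).
      rewrite (Cplus_comm (RtoC (1 - 2 * alpha))). field. lra. }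
  specialize (Hx (n - 1)%nat ltac:(lia)). replace (S (n - 1)) with n in Hx by lia.
  apply Rsqr_incr_0_var; [|apply Hpos]. now rewrite !Rsqr_pow2.
Qed.
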